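(* Let $\Omega\subset S^{n-1}$ be a closed set not contained in any closed hemisphere of $S^{n-1}$, and let $\rho_0:\Omega\to(0,\infty)$ and $g:\Omega\to\mathbb R$ be continuous. If $\langle\rho_t\rangle$ is a logarithmic family of convex hulls of $(\rho_0,g)$, then for $q\ne0$, $$\lim_{t\to0}\frac{\widetilde V_q(\langle\rho_t\rangle^* )-\widetilde V_q(\langle\rho_0\rangle^* )}{t}=-q\int_\Omega g(u)\,d\widetilde C_q(\langle\rho_0\rangle^*,u),$$ and $$\lim_{t\to0}\frac{\log\bar V_0(\langle\rho_t\rangle^* )-\log\bar V_0(\langle\rho_0\rangle^* )}{t}=-\frac1{\omega_n}\int_\Omega g(u)\,d\widetilde C_0(\langle\rho_0\rangle^*,u),$$ or equivalently, for each $q\in\mathbb R$, $$\frac{d}{dt}\log\bar V_q(\langle\rho_t\rangle^* )\Big|_{t=0}=-\frac1{\widetilde V_q(\langle\rho_0\rangle^* )}\int_\Omega g(u)\,d\widetilde C_q(\langle\rho_0\rangle^*,u).$$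
   Context: Logarithmic family of convex hulls of $(\rho_0,g)$: for some $\delta>0$ and each $t\in(-\delta,\delta)$, $\rho_t:\Omega\to(0,\infty)$ is continuous with $\log\rho_t(u)=\log\rho_0(u)+tg(u)+o(t,u)$, where $o(t,u)$ is continuous in $u\in\Omega$ and $o(t,u)/t\to0$ as $t\to0$ uniformly in $u\in\Omega$ (consistently with the given $\rho_0$ at $t=0$); $\langle\rho_t\rangle=\mathrm{conv}\{\rho_t(u)u:u\in\Omega\}$, a convex body (compact convex set with non-empty interior) with the origin in its interior. The polar of such a body $K$ is $K^*=\{x:x\cdot y\le1\text{ for all }y\in K\}$. For a convex body $K$ with the origin in its interior and $u,v\in S^{n-1}$: $h_K(v)=\max\{x\cdot v:x\in K\}$, $\rho_K(u)=\max\{\lambda:\lambda u\in K\}$, $r_K(u)=\rho_K(u)u$, $H_K(v)=\{x:x\cdot v=h_K(v)\}$. $du$ is spherical Lebesgue measure on $S^{n-1}$; $\omega_n$ is the volume of the unit ball of $\mathbb R^n$. Dual volumes: $\widetilde V_q(K)=\frac1n\int_{S^{n-1}}\rho_K^q(u)\,du$ for $q\in\mathbb R$; $\bar V_q(K)=\big(\frac1{n\omega_n}\int_{S^{n-1}}\rho_K^q(u)\,du\big)^{1/q}$ for $q\ne0$; $\bar V_0(K)=\exp\big(\frac1{n\omega_n}\int_{S^{n-1}}\log\rho_K(u)\,du\big)$. Dual curvature measures: $\pmb\alpha_K^*(\eta)=\{u\in S^{n-1}:r_K(u)\in H_K(v)\text{ for some }v\in\eta\}$ (Lebesgue measurable for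 Borel $\eta$), and $\widetilde C_q(K,\eta)=\frac1n\int_{\pmb\alpha_K^*(\eta)}\rho_K^q(u)\,du$ for Borel $\eta\subset S^{n-1}$; this is a Borel measure. *)

(* Defs.v *)
From HB Require Import structures.
From mathcomp Require Import all_boot all_order all_algebra.
From mathcomp Require Import all_classical all_reals all_analysis.

Set Implicit Arguments.
Unset Strict Implicit.
Unset Printing Implicit Defensive.

Import Order.TTheory GRing.Theory Num.Theory.
Import numFieldNormedType.Exports.

Local Open Scope classical_set_scope.
Local Open Scope ring_scope.

Section TupleLebesgue.
Context (R : realType).

Definition tuple_cons n (p : measurableTypeR R * n.-tuple (measurableTypeR R))
  : n.+1.-tuple (measurableTypeR R) := [tuple of p.1 :: p.2].

Lemma measurable_tuple_cons n : measurable_fun setT (@tuple_cons n).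
Proof. exact: measurable_cons. Qed.

Section step.
Variables (n : nat)
  (m : {sigma_finite_measure set (n.-tuple (measurableTypeR R)) -> \bar R}).

Definition tuple_lebesgue_step : set (n.+1.-tuple (measurableTypeR R)) -> \bar R :=
  pushforward ((@lebesgue_measure R) \x m)%E (@tuple_cons n).

Lemma tuple_lebesgue_step0 : tuple_lebesgue_step set0 = 0%E.
Proof. by rewrite /tuple_lebesgue_step /pushforward preimage_set0 measure0. Qed.

Lemma tuple_lebesgue_step_ge0 A : (0 <= tuple_lebesgue_step A)%E.
Proof. by rewrite /tuple_lebesgue_step /pushforward; exact: measure_ge0. Qed.

Lemma tuple_lebesgue_step_sigma_additive : semi_sigma_additive tuple_lebesgue_step.
Proof.
move=> F mF tF mUF; rewrite /tuple_lebesgue_step /pushforward preimage_bigcup.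
have mp A : measurable A -> measurable (@tuple_cons n @^-1` A).
  by move=> mA; rewrite -[X in measurable X]setTI; exact: measurable_tuple_cons.
apply: measure_semi_sigma_additive.
- by move=> k; exact: mp.
- apply/trivIsetP => /= i j _ _ ij; rewrite -preimage_setI.
  by move/trivIsetP : tF => /(_ _ _ _ _ ij) ->//; rewrite preimage_set0.
- by rewrite -preimage_bigcup; exact: mp.
Qed.

HB.instance Definition _ := isMeasure.Build _ _ _
  tuple_lebesgue_step tuple_lebesgue_step0 tuple_lebesgue_step_ge0
  tuple_lebesgue_step_sigma_additive.

Lemma tuple_lebesgue_step_sigma_finite : sigma_finite setT tuple_lebesgue_step.
Proof.
have /sigma_finiteP[F [TF ndF Foo]] := sigma_finiteT (@lebesgue_measure R).
have /sigma_finiteP[G [TG ndG Goo]] := sigma_finiteT m.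
pose uncons (t : n.+1.-tuple (measurableTypeR R)) := (tnth t ord0, [tuple of behead t]).
have muncons : measurable_fun setT uncons.
  apply: measurable_fun_pair; [exact: measurable_tnth|exact: measurable_behead].
have unconsK p : uncons (@tuple_cons n p) = p.
  by case: p => a b; congr pair; apply/val_inj.
exists (fun k => uncons @^-1` (F k `*` G k)).
  apply/esym; rewrite -subTset => t _.
  have [i _ Fi] : (\bigcup_k F k) (uncons t).1 by rewrite -TF.
  have [j _ Gj] : (\bigcup_k G k) (uncons t).2 by rewrite -TG.
  exists (maxn i j) => //; split.
  - by move: Fi; apply: (subsetPset _ _ (ndF _ _ (leq_maxl i j))).
  - by move: Gj; apply: (subsetPset _ _ (ndG _ _ (leq_maxr i j))).
move=> k; have [mF Fk] := Foo k; have [mG Gk] := Goo k.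
split.
  by rewrite -[X in measurable X]setTI; apply: muncons => //; exact: measurableX.
rewrite /tuple_lebesgue_step /pushforward.
rewrite (_ : _ @^-1` _ = F k `*` G k).
  by rewrite product_measure1E// lte_mul_pinfty// ge0_fin_numE.
by apply/seteqP; split => p; rewrite /preimage /mkset unconsK.
Qed.

HB.instance Definition _ := Measure_isSigmaFinite.Build _ _ _
  tuple_lebesgue_step tuple_lebesgue_step_sigma_finite.

End step.

Fixpoint tuple_lebesgue n :
    {sigma_finite_measure set (n.-tuple (measurableTypeR R)) -> \bar R} :=
  match n with
  | 0 => \d_([tuple] : 0.-tuple (measurableTypeR R))
  | n'.+1 => tuple_lebesgue_step (tuple_lebesgue n')
  end.

End TupleLebesgue.

Section Euclidean.
Context (R : realType) (n : nat).
Implicit Types (x y u v : 'rV[R]_n) (A : set 'rV[R]_n).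

Definition dot x y : R := \sum_(i < n) x 0 i * y 0 i.

Definition enorm x : R := Num.sqrt (dot x x).

Definition sphere : set 'rV[R]_n := [set u | enorm u = 1].

Definition borel_rV := g_sigma_algebraType (@open 'rV[R]_n).

Definition row_of_tuple (t : n.-tuple (measurableTypeR R)) : borel_rV :=
  \row_i tnth t i.

Lemma measurable_row_of_tuple : measurable_fun setT row_of_tuple.
Proof.
apply: (@measurability _ _ _ borel_rV setT row_of_tuple (@open 'rV[R]_n) erefl).
move=> _ [U oU <-].
rewrite setTI.
pose B (p : nat * 'rV[rat]_n) : set 'rV[R]_n :=
  [set x | forall i, `|ratr (p.2 0 i) - x 0 i| < p.1.+1%:R^-1].
have UE : U = \bigcup_(p in [set p | B p `<=` U]) B p.
  apply/seteqP; split => [x Ux|x [p pU /pU//]].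
  have [e /= e0 xeU] : exists2 e : R, 0 < e & ball x e `<=` U.
    by apply/nbhs_ballP; exact: oU.
  have [k _ ke] : exists2 k, True & k.+1%:R^-1 < e / 2.
    have e20 : 0 < e / 2 by rewrite divr_gt0.
    have [k _ /(_ k (leqnn k)) /= hk] := near_infty_natSinv_lt (PosNum e20).
    by exists k.
  have k0 : (0 : R) < k.+1%:R^-1 by rewrite invr_gt0.
  have /choice[q qx] : forall i, exists q : rat, `|ratr q - x 0 i| < k.+1%:R^-1.
    move=> i; have : x 0 i - k.+1%:R^-1 < x 0 i + k.+1%:R^-1.
      by rewrite ltrBlDr -addrA ltrDl addr_gt0.
    move=> /rat_in_itvoo[q]; rewrite in_itv/= => /andP[q1 q2].
    by exists q; rewrite ltr_norml ltrBlDl q2 andbT ltrBrDl.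
  exists (k, \row_i q i) => [y By|i] /=; last by rewrite mxE.
  apply: xeU; split => // i j; rewrite ord1 {i}.
  have := By j; rewrite /= mxE => yj.
  rewrite /ball/= (_ : x 0 j - y 0 j = (ratr (q j) - y 0 j) - (ratr (q j) - x 0 j)).
    rewrite (le_lt_trans (ler_normB _ _))// [ltRHS](splitr e) ltrD//.
      exact: lt_trans ke.
    exact: lt_trans ke.
  by rewrite opprB [RHS]addrC addrA subrK.
rewrite UE preimage_bigcup.
rewrite bigcup_mkcond; apply: countable_bigcupT_measurable => // p.
case: ifPn => // _.
have -> : row_of_tuple @^-1` B p = \bigcap_(i in [set: 'I_n])
    ((fun t => tnth t i) @^-1`
      [set a : measurableTypeR R | `|ratr (p.2 0 i) - a| < p.1.+1%:R^-1]).
  apply/seteqP; split => t Bt i; have := Bt i; rewrite /= !mxE; first by [].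
  by apply.
apply: fin_bigcap_measurable => // i _.
rewrite -[X in measurable X]setTI; apply: measurable_tnth => //.
rewrite [X in measurable X](_ : _ = ball (ratr (p.2 0 i) : R) p.1.+1%:R^-1) //.
by rewrite ball_itv; exact: measurable_itv.
Qed.

(* [volume] is n-dimensional Lebesgue measure on the Borel sets of R^n; it lives
   on tuples first because these already carry the product sigma-algebra. *)
Definition volume : set borel_rV -> \bar R :=
  pushforward (tuple_lebesgue R n) row_of_tuple.

Lemma volume0 : volume set0 = 0%E.
Proof. by rewrite /volume /pushforward preimage_set0 measure0. Qed.

Lemma volume_ge0 A : (0 <= volume A)%E.
Proof. by rewrite /volume /pushforward; exact: measure_ge0. Qed.

Lemma volume_sigma_additive : semi_sigma_additive volume.
Proof.
move=> F mF tF mUF; rewrite /volume /pushforward preimage_bigcup.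
have mp B : measurable B -> measurable (row_of_tuple @^-1` B).
  by move=> mB; rewrite -[X in measurable X]setTI; exact: measurable_row_of_tuple.
apply: measure_semi_sigma_additive.
- by move=> k; exact: mp.
- apply/trivIsetP => /= i j _ _ ij; rewrite -preimage_setI.
  by move/trivIsetP : tF => /(_ _ _ _ _ ij) ->//; rewrite preimage_set0.
- by rewrite -preimage_bigcup; exact: mp.
Qed.

HB.instance Definition _ := isMeasure.Build _ _ _
  volume volume0 volume_ge0 volume_sigma_additive.

Definition unit_ball_volume : R := fine (volume [set x | enorm x <= 1]).

Definition cone A : set 'rV[R]_n :=
  [set x | 0 < enorm x <= 1 /\ A ((enorm x)^-1 *: x)].

Lemma continuous_enorm : continuous enorm.
Proof.
move=> x; apply: (@continuous_comp _ _ _ (fun y => dot y y) Num.sqrt).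
  rewrite /dot; apply: (@continuous_big R 'I_n +%R 0 xpredT) => [y|i _ y].
    exact: add_continuous.
  have ci : {for y, continuous (fun z : 'rV[R]_n => z 0 i)} by exact: coord_continuous.
  exact: (continuousM ci ci).
exact: sqrt_continuous.
Qed.

Lemma measurable_open (U : set 'rV[R]_n) :
  open U -> measurable (U : set borel_rV).
Proof. exact: sub_sigma_algebra. Qed.

Lemma continuous_normalize x : 0 < enorm x ->
  {for x, continuous (fun y : 'rV[R]_n => (enorm y)^-1 *: y)}.
Proof.
move=> x0.
have cV : {for x, continuous (fun y : 'rV[R]_n => (enorm y)^-1)}.
  by apply: continuousV; [rewrite gt_eqF|exact: continuous_enorm].
by apply: (continuousZ cV); exact: cvg_id.
Qed.

Lemma measurable_cone A :
  measurable (A : set borel_rV) -> measurable (cone A : set borel_rV).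
Proof.
move=> mA.
pose N := fun x : borel_rV => (enorm x)^-1 *: x : borel_rV.
have mN : measurable_fun [set x : borel_rV | 0 < enorm x] N.
  apply: (@measurability _ _ borel_rV borel_rV _ N (@open 'rV[R]_n) erefl).
  move=> _ [U oU <-]; apply: measurable_open.
  have o0 : open [set x | 0 < enorm x].
    by apply: (@open_comp _ _ enorm [set r | 0 < r]) => [x _|];
      [exact: continuous_enorm|exact: open_gt].
  rewrite openE => x [x0 Ux]; apply: filterI; first exact: open_nbhs_nbhs.
  have cN := continuous_normalize x0.
  exact: (cN U (open_nbhs_nbhs (conj oU Ux))).
have m0 : measurable ([set x : borel_rV | 0 < enorm x]).
  apply: measurable_open; apply: (@open_comp _ _ enorm [set r | 0 < r]) => [x _|];
    [exact: continuous_enorm|exact: open_gt].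
have m1 : measurable ([set x : borel_rV | enorm x <= 1]).
  rewrite (_ : mkset _ = ~` [set x | 1 < enorm x]); last first.
    by apply/seteqP; split => x /=; rewrite leNgt => /negP.
  apply: measurableC.
  apply: measurable_open; apply: (@open_comp _ _ enorm [set r | 1 < r]) => [x _|];
    [exact: continuous_enorm|exact: open_gt].
rewrite (_ : cone A = [set x : borel_rV | enorm x <= 1] `&`
    ([set x : borel_rV | 0 < enorm x] `&` N @^-1` A)).
  by apply: measurableI => //; exact: mN.
apply/seteqP; split => x; rewrite /cone /=.
  by move=> [/andP[]].
by move=> [? [? ?]]; split => //; apply/andP.
Qed.

Lemma cone_bigcup (F : (set 'rV[R]_n)^nat) : cone (\bigcup_k F k) = \bigcup_k cone (F k).
Proof.
apply/seteqP; split => [x [x01 [k _ Fk]]|x [k _ [x01 Fk]]].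
  by exists k.
by split => //; exists k.
Qed.

(* The library has no surface measure; spherical Lebesgue measure is obtained
   from the volume of cones: sigma(A) = n vol {r u | u in A, 0 < r <= 1}.
   It is carried by the ambient space: only [A `&` sphere] contributes. *)
Definition sphere_borel (A : set borel_rV) : \bar R :=
  (n%:R%:E * volume (cone A))%E.

Lemma sphere_borel0 : sphere_borel set0 = 0%E.
Proof.
rewrite /sphere_borel (_ : cone set0 = set0) ?measure0 ?mule0//.
by apply/seteqP; split => x // [].
Qed.

Lemma sphere_borel_ge0 A : (0 <= sphere_borel A)%E.
Proof. by apply: mule_ge0 => //; rewrite lee_fin. Qed.

Lemma sphere_borel_sigma_additive : semi_sigma_additive sphere_borel.
Proof.
move=> F mF tF mUF; rewrite /sphere_borel cone_bigcup.
have mc k : measurable (cone (F k) : set borel_rV) by exact: measurable_cone.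
apply: (@measure_semi_sigma_additive _ _ _ (mscale n%:R%:nng volume)) => //.
- apply/trivIsetP => i j _ _ ij; move/trivIsetP : tF => /(_ _ _ I I ij) Fij.
  rewrite -subset0 => x [[_ Fi] [_ Fj]].
  have : (F i `&` F j) ((enorm x)^-1 *: x) by [].
  by rewrite Fij.
- by rewrite -cone_bigcup; exact: measurable_cone.
Qed.

HB.instance Definition _ := isMeasure.Build _ _ _
  sphere_borel sphere_borel0 sphere_borel_ge0 sphere_borel_sigma_additive.

(* The completion, so that all Lebesgue measurable subsets of the sphere are
   measurable, not just the Borel ones. *)
Definition sphere_measure := @completed_measure_extension _ _ _ sphere_borel.

HB.instance Definition _ := Measure.on sphere_measure.

Implicit Types (K Omega : set 'rV[R]_n) (q : R) (rho g : 'rV[R]_n -> R).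

Definition support_function K v : R := sup [set dot x v | x in K].

Definition radial K u : R := sup [set l : R | K (l *: u)].

Definition radial_map K u : 'rV[R]_n := radial K u *: u.

Definition support_hyperplane K v : set 'rV[R]_n :=
  [set x | dot x v = support_function K v].

Definition polar K : set 'rV[R]_n :=
  [set x | forall y, K y -> dot x y <= 1].

Definition dual_volume q K : R :=
  n%:R^-1 * \int[sphere_measure]_(u in sphere) (radial K u `^ q).

Definition normalized_dual_volume q K : R :=
  let c := (n%:R * unit_ball_volume)^-1 in
  if q == 0 then expR (c * \int[sphere_measure]_(u in sphere) ln (radial K u))
  else (c * \int[sphere_measure]_(u in sphere) (radial K u `^ q)) `^ q^-1.

Definition reverse_radial_gauss_image K (eta : set 'rV[R]_n) : set 'rV[R]_n :=
  [set u | sphere u /\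
    exists2 v, (sphere `&` eta) v & support_hyperplane K v (radial_map K u)].

(* A bare set function: [integral] does not require a bundled measure.  It is
   only meant to be evaluated at Borel sets, where it is the dual curvature
   measure; the integral below evaluates it at such sets only. *)
Definition dual_curvature q K (eta : set borel_rV) : \bar R :=
  (n%:R^-1%:E * \int[sphere_measure]_(u in reverse_radial_gauss_image K eta)
                  (radial K u `^ q)%:E)%E.

Definition dual_curvature_integral q K Omega g : R :=
  fine (\int[dual_curvature q K]_(u in Omega) (g u)%:E)%E.

Definition closed_hemisphere v : set 'rV[R]_n :=
  [set u | sphere u /\ 0 <= dot u v].

Definition convex_hull A : set 'rV[R]_n :=
  smallest (fun C => convex_set C) A.

Definition hull_of Omega rho : set 'rV[R]_n :=
  convex_hull [set rho u *: u | u in Omega].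

(* [rho t] and [o t] are only constrained for [t] in (-delta, delta) and on
   [Omega]; their values elsewhere are irrelevant. *)
Definition log_family Omega rho0 g (rho : R -> 'rV[R]_n -> R) : Prop :=
  (forall u, Omega u -> rho 0 u = rho0 u) /\
  exists2 delta : R, 0 < delta & exists o : R -> 'rV[R]_n -> R,
    [/\ forall t, `|t| < delta ->
          {within Omega, continuous (rho t)} /\
          forall u, Omega u -> 0 < rho t u,
        forall t, `|t| < delta -> {within Omega, continuous (o t)},
        forall t, `|t| < delta -> forall u, Omega u ->
          ln (rho t u) = ln (rho0 u) + t * g u + o t u &
        forall e : R, 0 < e ->
          \forall t \near 0^', forall u, Omega u -> `|o t u / t| < e].

End Euclidean.

Arguments sphere {R n}.
Arguments unit_ball_volume : clear implicits.

(* Main.v *)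
Require Import Defs.
From HB Require Import structures.
From mathcomp Require Import all_boot all_order all_algebra.
From mathcomp Require Import all_classical all_reals all_analysis.
From mathcomp Require Import measurable_realfun ring lra.

Set Implicit Arguments.
Unset Strict Implicit.
Unset Printing Implicit Defensive.

Import Order.TTheory GRing.Theory Num.Theory.
Import numFieldNormedType.Exports.

Local Open Scope classical_set_scope.
Local Open Scope ring_scope.

(** Write P for the set of points rho u *: u with u in Omega, and h for the
support function of its hull, h x = max over Omega of rho u * dot u x. The
radial function of the polar body is 1 / h, so the q-th dual volume of the
polar is the integral of h to the power - q over the sphere, divided by n. The
theorem is the differentiation of this integral in t, where h_t comes from
rho_t.

For a direction x at which a single tau x in Omega realizes the maximum h_0 x,
the envelope principle gives the derivative of ln (h_t x) at t = 0: it is the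
derivative g (tau x) of ln (rho_t (tau x)), because by compactness the points
away from tau x stay too low to compete ([cvg_ln_hull_support]). The bound
[ln_hull_support_lipschitz] is uniform in the direction, so dominated
convergence differentiates the integral as soon as the maximizer is unique for
almost every direction.

That uniqueness is the only analytic difficulty. Almost everywhere
differentiability of the convex function h would imply it; a more elementary
argument works here. If two maximizers at x give points of P with different
i-th coordinates, these two values bound an interval. When x moves along the
i-th axis, the i-th coordinates of the maximizing points increase, so the
intervals met on one line are disjoint, each contains a rational, and there are
countably many of them ([countable_kink_line]). By Fubini the set of such x has
volume zero ([volume_kinks]), and being invariant under dilations it is
negligible for the spherical measure.

It remains to recognize the limit. Outside the negligible set, a direction u
belongs to the reverse radial Gauss image of eta for the polar body exactly
when tau u lies in eta ([reverse_radial_gauss_imageP]). So the dual curvature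
measure of the polar is the image under tau of a measure with density h^(-q) / n
([dual_curvatureE]), and integrating g against it gives the integral over the
sphere of (g o tau) h^(-q) / n ([dual_curvature_integralE]), which is the one
produced by the differentiation. The three formulas then follow from the chain
rule. *)

(** * Differentiation under the integral and densities *)

(** Dominated convergence along arbitrary sequences tending to 0: the difference
quotients are bounded by the constant M, which is integrable on a set of finite
measure. *)
Lemma derivative_under_Rintegral (R : realType) d (T : measurableType d)
    (mu : {measure set T -> \bar R}) (D : set T) (F : R -> T -> R) (G : T -> R)
    (M : R) :
  measurable D -> (mu D < +oo)%E ->
  (\forall t \near 0, mu.-integrable D (EFin \o F t)) ->
  (\forall t \near 0, forall x, D x -> `|F t x - F 0 x| <= M * `|t|) ->
  {ae mu, forall x, D x -> (F t x - F 0 x) / t @[t --> 0^'] --> G x} ->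
  measurable_fun D G ->
  (\int[mu]_(x in D) F t x - \int[mu]_(x in D) F 0 x) / t @[t --> 0^'] -->
    \int[mu]_(x in D) G x.
Proof.
move=> mD muD intF FM Fcvg mG.
have intF0 : mu.-integrable D (EFin \o F 0) by exact: nbhs_singleton intF.
apply/cvgr_dnbhsP => u [u0 ucvg].
have near0u (P : set R) : (\forall t \near 0, P t) -> \forall k \near \oo, P (u k).
  by move=> P0; exact: (ucvg _ P0).
have [N _ HN] : \forall k \near \oo, mu.-integrable D (EFin \o F (u k)) /\
    (forall x, D x -> `|F (u k) x - F 0 x| <= M * `|u k|).
  exact: near0u _ (filterI intF FM).
rewrite -(cvg_shiftn N).
pose Q k x := (F (u (k + N)%N) x - F 0 x) / u (k + N)%N.
have HN' k : mu.-integrable D (EFin \o F (u (k + N)%N)) /\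
    (forall x, D x -> `|F (u (k + N)%N) x - F 0 x| <= M * `|u (k + N)%N|).
  by apply: HN; rewrite /= leq_addl.
have iQ k : mu.-integrable D (EFin \o Q k).
  rewrite /Q /comp.
  under eq_fun do rewrite mulrC EFinM.
  apply: integrableZl => //.
  under eq_fun do rewrite EFinB.
  by apply: integrableB => //; exact: (HN' k).1.
have [|||||iG _ cvgI] := @dominated_convergence _ _ _ mu D mD
    (fun k => EFin \o Q k) (EFin \o G) (EFin \o cst M).
- by move=> k; exact: (measurable_int mu).
- exact/measurable_EFinP.
- apply: filterS Fcvg => x Fx Dx.
  apply: cvg_EFin; first exact: nearW.
  by move: (Fx Dx) => /cvgr_dnbhsP/(_ u (conj u0 ucvg)); rewrite -(cvg_shiftn N).
- apply: measurable_bounded_integrable => //; exact: bounded_cst.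
- apply: aeW => x k Dx; rewrite lee_fin /= /Q normrM normfV.
  by rewrite ler_pdivrMr ?normr_gt0//; exact: (HN' k).2.
rewrite (_ : (fun _ => _) = (fun k => \int[mu]_(x in D) Q k x)); last first.
  apply/funext => k; rewrite /Q RintegralZr//.
    by rewrite RintegralB//; exact: (HN' k).1.
  rewrite /comp; under eq_fun do rewrite EFinB.
  by apply: integrableB => //; exact: (HN' k).1.
apply: fine_cvg; rewrite fineK//; exact: integrable_fin_num.
Qed.

Section pushforward_density.
Local Open Scope ereal_scope.
Context d d' (T : measurableType d) (U : measurableType d') (R : realType).
Variables (mu : {measure set T -> \bar R}) (w : T -> R) (tau : T -> U).

(** The image under tau of the measure with density w with respect to mu. The
proofs are parameters so that the measure structure below can be attached to
the constant. *)
Definition pushforward_density (mtau : measurable_fun setT tau)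
    (mw : measurable_fun setT w) (w0 : forall x, (0 <= w x)%R) (A : set U) : \bar R :=
  \int[mu]_(x in tau @^-1` A) (w x)%:E.

Hypotheses (mtau : measurable_fun setT tau) (mw : measurable_fun setT w).
Hypothesis w0 : forall x, (0 <= w x)%R.

Local Notation nu := (pushforward_density mtau mw w0).

Let nu0 : nu set0 = 0.
Proof. by rewrite /pushforward_density preimage_set0 integral_set0. Qed.

Let nu_ge0 A : 0 <= nu A.
Proof. by apply: integral_ge0 => x _; rewrite lee_fin. Qed.

Let mpre A : measurable A -> measurable (tau @^-1` A).
Proof. by move=> mA; rewrite -[X in measurable X]setTI; exact: mtau. Qed.

Let nu_sigma_additive : semi_sigma_additive nu.
Proof.
move=> F mF tF mUF; rewrite /pushforward_density preimage_bigcup.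
apply: (@semi_sigma_additive_nng_induced _ _ _ mu (EFin \o w)).
- exact/measurable_EFinP.
- by move=> x; rewrite lee_fin.
- by move=> k; exact: mpre.
- apply/trivIsetP => /= i j _ _ ij; rewrite -preimage_setI.
  by move/trivIsetP : tF => /(_ _ _ _ _ ij) ->//; rewrite preimage_set0.
- by rewrite -preimage_bigcup; exact: mpre.
Qed.

HB.instance Definition _ := isMeasure.Build _ _ _ nu nu0 nu_ge0 nu_sigma_additive.

Import HBNNSimple.

Let integral_nnsfun_pushforward_density (h : {nnsfun U >-> R}) :
  \int[nu]_y (h y)%:E = \int[mu]_x ((h (tau x))%:E * (w x)%:E).
Proof.
rewrite integralT_nnsfun sintegralE.
have mh y : measurable (h @^-1` [set y]).
  by rewrite -[X in measurable X]setTI; exact: measurable_funP.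
under [RHS]eq_integral => x _.
  rewrite fimfunE -fsumEFin// ge0_mule_fsuml; last first.
    by move=> y; rewrite EFinM; exact: nnfun_muleindic_ge0.
  over.
rewrite ge0_integral_fsum//; last 2 first.
- move=> y; apply: emeasurable_funM; last exact/measurable_EFinP.
  apply/measurable_EFinP; apply: measurable_funM => //.
  by apply: measurableT_comp mtau; exact: measurable_indic.
- move=> y x _; rewrite mule_ge0 ?lee_fin//.
  by rewrite -lee_fin EFinM; exact: nnfun_muleindic_ge0.
apply: eq_fsbigr => y; rewrite inE => -[z _ <-].
rewrite /pushforward_density [X in _ * X]integral_mkcond -ge0_integralZl//; last 3 first.
- apply/(measurable_restrictT _ _).1; first exact: mpre.
  exact/measurable_funTS/measurable_EFinP.
- by move=> x _; apply: erestrict_ge0 => u _; rewrite lee_fin.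
- by rewrite lee_fin.
apply: eq_integral => x _; rewrite EFinM -muleA; congr (_ * _).
rewrite epatch_indic muleC; congr (_ * _).
Qed.

Lemma ge0_integral_pushforward_density (f : U -> \bar R) :
  measurable_fun setT f -> (forall y, 0 <= f y) ->
  \int[nu]_y f y = \int[mu]_x (f (tau x) * (w x)%:E).
Proof.
move=> mf f0; pose h := nnsfun_approx measurableT mf.
have hcvg y : (h k y)%:E @[k --> \oo] --> f y.
  by apply: (@cvg_nnsfun_approx _ _ _ _ measurableT f mf).
have mh k : measurable_fun setT (EFin \o h k) by exact/measurable_EFinP.
have hnd y : {homo (fun k => (h k y)%:E) : a b / (a <= b)%N >-> a <= b}.
  by move=> a b ab; rewrite lee_fin; exact/lefP/nd_nnsfun_approx.
have -> : \int[nu]_y f y = limn (fun k => \int[nu]_y (h k y)%:E).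
  rewrite -monotone_convergence//.
  - by apply: eq_integral => y _; apply/esym/cvg_lim.
  - by move=> k y _; rewrite lee_fin.
have -> : \int[mu]_x (f (tau x) * (w x)%:E) =
    limn (fun k => \int[mu]_x ((h k (tau x))%:E * (w x)%:E)).
  rewrite -monotone_convergence//; last 3 first.
  - move=> k; apply: emeasurable_funM; last exact/measurable_EFinP.
    exact: measurableT_comp (mh k) mtau.
  - by move=> k x _; rewrite mule_ge0 ?lee_fin.
  - by move=> x _ a b ab; apply: lee_wpmul2r; rewrite ?lee_fin//; exact: hnd.
  apply: eq_integral => x _; apply/esym/cvg_lim => //.
  by apply: cvgeZr.
by congr (limn _); apply/funext => k; exact: integral_nnsfun_pushforward_density.
Qed.

(** Both sides are, by definition, differences of the integrals of the positive and
negative parts, and a nonnegative density preserves these parts. *)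
Lemma integral_pushforward_density (f : U -> \bar R) :
  measurable_fun setT f ->
  \int[nu]_y f y = \int[mu]_x (f (tau x) * (w x)%:E).
Proof.
move=> mf; rewrite [LHS]integralE [RHS]integralE.
rewrite !ge0_integral_pushforward_density//; last 2 first.
- exact: measurable_funeneg.
- exact: measurable_funepos.
have w0x x : 0 <= (w x)%:E by rewrite lee_fin.
congr (_ - _); apply: eq_integral => x _.
- by rewrite !funeposE muleC (muleC (f _)) maxe_pMr// mule0.
- by rewrite !funenegE muleC (muleC (f _)) -muleN maxe_pMr// mule0.
Qed.

End pushforward_density.

Section eq_set_function_integral.
Import HBNNSimple.

(** The integral is defined by suprema over measurable simple functions, so it reads
the set function on measurable sets only. This permits replacing the bare set
function [dual_curvature] by a genuine measure. *)
Lemma eq_set_function_integral d (T : measurableType d) (R : realType)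
    (m m' : set T -> \bar R) (D : set T) (f : T -> \bar R) :
  (forall A, measurable A -> m A = m' A) ->
  (\int[m]_(x in D) f x = \int[m']_(x in D) f x)%E.
Proof.
move=> mm'; rewrite /integral.
have mE (A : set {nnsfun T >-> R}) :
    [set sintegral m h | h in A] = [set sintegral m' h | h in A].
  apply: eq_imagel => h _; rewrite /sintegral; apply: eq_fsbigr => y _.
  by rewrite mm'// -[X in measurable X]setTI; exact: measurable_funP.
by congr (ereal_sup _ - ereal_sup _)%E.
Qed.

End eq_set_function_integral.

(** * Lebesgue measure on tuples along coordinate lines *)

Section tuple_lebesgue_facts.
Context (R : realType).

Definition tuple_update n (t : n.-tuple (measurableTypeR R)) (i : 'I_n) (s : R) :
    n.-tuple (measurableTypeR R) :=
  [tuple if j == i then s else tnth t j | j < n].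

Lemma tuple_update_cons0 n a (t : n.-tuple (measurableTypeR R)) s :
  tuple_update (tuple_cons (a, t)) ord0 s = tuple_cons (s, t).
Proof.
apply: eq_from_tnth => j; rewrite tnth_mktuple.
by case: (unliftP ord0 j) => [k ->|->]; rewrite /= ?tnthS.
Qed.

Lemma tuple_update_consS n a (t : n.-tuple (measurableTypeR R)) i s :
  tuple_update (tuple_cons (a, t)) (lift ord0 i) s =
  tuple_cons (a, tuple_update t i s).
Proof.
apply: eq_from_tnth => j; rewrite tnth_mktuple.
case: (unliftP ord0 j) => [k ->|->]//=.
by rewrite !tnthS tnth_mktuple (inj_eq lift_inj).
Qed.

(** Fubini, by induction on the dimension: for the first coordinate, slice by fixing
the others; for a later one, fix the first coordinate and apply the induction
hypothesis to the slice. *)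
Lemma tuple_lebesgue_countable_lines n (i : 'I_n)
    (E : set (n.-tuple (measurableTypeR R))) :
  measurable E ->
  (forall t, countable [set s : R | E (tuple_update t i s)]) ->
  tuple_lebesgue R n E = 0%E.
Proof.
elim: n i E => [[]//|n IHn] i E mE cE.
have mE' : measurable (@tuple_cons R n @^-1` E).
  by rewrite -[X in measurable X]setTI; exact: measurable_tuple_cons.
rewrite /= /tuple_lebesgue_step /pushforward.
case: (unliftP ord0 i) cE => [j ->|->] cE.
  apply: integral0_eq => a _ /=.
  apply: (IHn j); first exact: measurable_xsection.
  move=> t; apply: sub_countable (cE (tuple_cons (a, t))).
  apply: subset_card_le => s /=.
  by rewrite /xsection /= inE tuple_update_consS.
rewrite (@product_measure_unique _ _ _ _ _ _ (tuple_lebesgue R n)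
  (lebesgue_measure \x^ tuple_lebesgue R n)%E)//; last first.
  by move=> A B mA mB; exact: product_measure2E.
apply: integral0_eq => t _ /=.
apply: countable_lebesgue_measure0.
apply: sub_countable (cE (tuple_cons (0, t))).
apply: subset_card_le => s /=.
by rewrite /ysection /= inE tuple_update_cons0.
Qed.

(** The volume of cubes alone shows that the ball has finite and positive volume and
that points are negligible. *)
Lemma tuple_lebesgue_cube n (a : R) : 0 <= a ->
  tuple_lebesgue R n [set t | forall i, `|tnth t i| <= a] = ((a *+ 2) ^+ n)%:E.
Proof.
move=> a0; elim: n => [|n IHn].
  rewrite /= expr0 diracE mem_set// => -[]//.
rewrite /= /tuple_lebesgue_step /pushforward.
rewrite (_ : _ @^-1` _ = `[- a, a]%classic `*` [set t | forall i, `|tnth t i| <= a]).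
  rewrite product_measure1E//; last first.
    rewrite (_ : mkset _ = \bigcap_(i in [set: 'I_n])
        ((fun t => tnth t i) @^-1` `[- a, a])).
      apply: fin_bigcap_measurable => // i _.
      by rewrite -[X in measurable X]setTI; exact: measurable_tnth.
    apply/seteqP; split => t ta i; have := ta i.
      by rewrite /= in_itv/= ler_norml.
    by rewrite /= in_itv/= -ler_norml; apply.
  rewrite IHn exprS EFinM; congr (_ * _)%E.
  have /= -> := lebesgue_measure_itv (`[- a, a] : interval R).
  by rewrite lte_fin; case: ltP => ?; rewrite -?EFinB; congr (_%:E); lra.
apply/seteqP; split => -[b t] /=.
  move=> H; split; first by have := H ord0; rewrite in_itv/= ler_norml.
  by move=> i; have := H (lift ord0 i); rewrite tnthS.
move=> [ba H] i; case: (unliftP ord0 i) => [j ->|->]; first by rewrite tnthS; exact: H.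
by move: ba; rewrite in_itv/= -ler_norml.
Qed.

End tuple_lebesgue_facts.

(** * Euclidean norm and volume *)

Section euclidean_facts.
Context (R : realType) (n : nat).
Implicit Types x y u v : 'rV[R]_n.

Lemma dotC x y : dot x y = dot y x.
Proof. by rewrite /dot; apply: eq_bigr => i _; rewrite mulrC. Qed.

Lemma dotDl x y z : dot (x + y) z = dot x z + dot y z.
Proof. by rewrite /dot -big_split; apply: eq_bigr => i _; rewrite mxE mulrDl. Qed.

Lemma dotZl a x y : dot (a *: x) y = a * dot x y.
Proof. by rewrite /dot mulr_sumr; apply: eq_bigr => i _; rewrite mxE mulrA. Qed.

Lemma dotNl x y : dot (- x) y = - dot x y.
Proof. by rewrite -scaleN1r dotZl mulN1r. Qed.

Lemma dotDr x y z : dot x (y + z) = dot x y + dot x z.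
Proof. by rewrite dotC dotDl !(dotC x). Qed.

Lemma dotZr a x y : dot x (a *: y) = a * dot x y.
Proof. by rewrite dotC dotZl (dotC x). Qed.

Lemma dotNr x y : dot x (- y) = - dot x y.
Proof. by rewrite dotC dotNl (dotC x). Qed.

Lemma dot_delta x i : dot x (delta_mx 0 i) = x 0 i.
Proof.
rewrite /dot (bigD1 i)//= big1 ?addr0 ?mxE ?eqxx ?mulr1// => j ji.
by rewrite mxE (negbTE ji) mulr0.
Qed.

Lemma dot_ge0 x : 0 <= dot x x.
Proof. by apply: sumr_ge0 => i _; rewrite -expr2 sqr_ge0. Qed.

Lemma sqr_enorm x : enorm x ^+ 2 = dot x x.
Proof. by rewrite /enorm sqr_sqrtr// dot_ge0. Qed.

Lemma enorm_ge0 x : 0 <= enorm x.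
Proof. exact: sqrtr_ge0. Qed.

Lemma enormZ a x : enorm (a *: x) = `|a| * enorm x.
Proof.
by rewrite /enorm dotZl dotZr mulrA -expr2 sqrtrM ?sqr_ge0// sqrtr_sqr.
Qed.

Lemma normr_coord_enorm x i : `|x 0 i| <= enorm x.
Proof.
rewrite -(ler_pXn2r (_ : 0 < 2)%N) ?nnegrE ?enorm_ge0// sqr_enorm.
rewrite real_normK ?num_real// /dot (bigD1 i)//= expr2 lerDl.
by apply: sumr_ge0 => j _; rewrite -expr2 sqr_ge0.
Qed.

Lemma enorm_gt0 x : (0 < enorm x) = (x != 0).
Proof.
rewrite lt_neqAle enorm_ge0 andbT eq_sym; congr (~~ _); apply/eqP/eqP => [x0|->].
  apply/rowP => i; rewrite mxE; apply/eqP; rewrite -normr_le0 -x0.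
  exact: normr_coord_enorm.
by rewrite /enorm /dot big1 ?sqrtr0// => i _; rewrite mxE mul0r.
Qed.

Lemma enorm_le1 x : (0 < n)%N -> (forall i, `|x 0 i| <= n%:R^-1) -> enorm x <= 1.
Proof.
move=> n0 xn; rewrite -(ler_pXn2r (_ : 0 < 2)%N) ?nnegrE ?enorm_ge0//.
rewrite sqr_enorm expr1n.
have n0' : 0 < n%:R :> R by rewrite ltr0n.
apply: (@le_trans _ _ (\sum_(i < n) n%:R^-1)); last first.
  by rewrite sumr_const card_ord -[leLHS]mulr_natl mulfV ?gt_eqF.
apply: ler_sum => i _; rewrite -expr2 -real_normK ?num_real//.
rewrite expr2 -[leRHS]mulr1 ler_pM// (le_trans (xn i))// invf_le1//.
by rewrite ler1n.
Qed.

(** Equality case of Cauchy-Schwarz: the square of the norm of u - v is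
2 - 2 dot u v. *)
Lemma dot_sphere_lt1 u v : sphere u -> sphere v -> u != v -> dot u v < 1.
Proof.
move=> u1 v1 uv; rewrite -subr_gt0.
have : 0 < enorm (u - v) by rewrite enorm_gt0 subr_eq0.
rewrite -(ltr_pXn2r (_ : 0 < 2)%N) ?nnegrE ?enorm_ge0// expr0n/= sqr_enorm.
rewrite dotDl !dotDr !dotNl !dotNr -!sqr_enorm u1 v1 (dotC v u); lra.
Qed.

Lemma cvg_dot (T : Type) (F : set_system T) (f g : T -> 'rV[R]_n) x y :
  Filter F -> f @ F --> x -> g @ F --> y -> dot (f t) (g t) @[t --> F] --> dot x y.
Proof.
move=> FF fx gy; apply: (@cvg_big _ 'I_n +%R) => [z|i _]; first exact: add_continuous.
apply: cvgM.
  exact: (cvg_comp _ _ fx (@coord_continuous _ _ _ 0 i x)).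
exact: (cvg_comp _ _ gy (@coord_continuous _ _ _ 0 i y)).
Qed.

Lemma closed_sphere : closed (sphere : set 'rV[R]_n).
Proof.
have cE : {in ~` (@enorm R n @^-1` [set 1]), continuous (@enorm R n)}.
  by move=> x _; exact: continuous_enorm.
exact: (preimage_closed cE (@closed_eq R 1)).
Qed.

Lemma compact_sphere : compact (sphere : set 'rV[R]_n).
Proof.
apply: bounded_closed_compact closed_sphere.
exists 1; split=> // M M1 x x1 /=; rewrite [X in X <= _]mx_normrE.
apply: bigmax_le => [|[j i] _ /=]; first by rewrite (le_trans _ (ltW M1)).
by rewrite (ord1 j) (le_trans (normr_coord_enorm _ _))// x1 ltW.
Qed.

End euclidean_facts.

Section volume_facts.
Context (R : realType) (n : nat).

Let row_of_tupleE (t : n.-tuple (measurableTypeR R)) i :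
  row_of_tuple t 0 i = tnth t i.
Proof. by rewrite mxE. Qed.

Lemma volume_cube (a : R) : 0 <= a ->
  volume [set x : 'rV[R]_n | forall i, `|x 0 i| <= a] = ((a *+ 2) ^+ n)%:E.
Proof.
move=> a0; rewrite -tuple_lebesgue_cube// /volume /pushforward; congr (_ _).
by apply/seteqP; split => t /= H i; have := H i; rewrite row_of_tupleE.
Qed.

Lemma volume_countable_lines (i : 'I_n) (E : set (borel_rV R n)) :
  measurable E ->
  (forall x, countable [set s : R | E (x + s *: delta_mx 0 i)]) ->
  volume E = 0%E.
Proof.
move=> mE cE; rewrite /volume /pushforward.
apply: (tuple_lebesgue_countable_lines (i := i)).
  by rewrite -[X in measurable X]setTI; exact: measurable_row_of_tuple.
move=> t; apply: sub_countable (cE (row_of_tuple (tuple_update t i 0))).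
apply: subset_card_le => s /=; congr E; apply/rowP => j.
rewrite !mxE !tnth_mktuple; case: eqP => _; rewrite ?mulr1 ?add0r//.
by rewrite mulr0 addr0.
Qed.

Lemma measurable_closed (C : set 'rV[R]_n) :
  closed C -> measurable (C : set (borel_rV R n)).
Proof.
move=> cC; rewrite -[C]setCK; apply: measurableC; apply: measurable_open.
by rewrite openC.
Qed.

Let closed_ball_le1 : measurable ([set x | enorm x <= 1] : set (borel_rV R n)).
Proof.
apply: measurable_closed.
have cE : {in ~` (@enorm R n @^-1` [set r | r <= 1]), continuous (@enorm R n)}.
  by move=> x _; exact: continuous_enorm.
exact: (preimage_closed cE (@closed_le R 1)).
Qed.

Let mcube (a : R) : measurable ([set x | forall i, `|x 0 i| <= a] : set (borel_rV R n)).
Proof.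
apply: (@measurable_closed [set x : 'rV[R]_n | forall i, `|x 0 i| <= a]).
have -> : [set x : 'rV[R]_n | forall i, `|x 0 i| <= a] =
    \bigcap_(i in [set: 'I_n]) [set x | `|x 0 i| <= a].
  by apply/seteqP; split => x /= xa i; [move=> _|]; exact: xa.
apply: closed_bigI => i _.
have cE : {in ~` ((fun x : 'rV[R]_n => `|x 0 i|) @^-1` [set r | r <= a]),
    continuous (fun x : 'rV[R]_n => `|x 0 i|)}.
  move=> x _.
  apply: (@continuous_comp _ _ _ (fun x : 'rV[R]_n => x 0 i) (fun r : R => `|r|)).
    exact: coord_continuous.
  exact: norm_continuous.
exact: (preimage_closed cE (@closed_le R a)).
Qed.

Lemma volume_ball_lty : (volume [set x : 'rV[R]_n | (enorm x <= 1)%R] < +oo)%E.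
Proof.
have le_cube : (volume [set x : 'rV[R]_n | (enorm x <= 1)%R] <=
    volume [set x : 'rV[R]_n | forall i, (`|x 0 i| <= 1)%R])%E.
  apply: le_measure; rewrite ?inE; [exact: closed_ball_le1|exact: mcube|].
  by move=> x /= x1 i; exact: le_trans (normr_coord_enorm _ _) x1.
by rewrite (le_lt_trans le_cube)// volume_cube// ltry.
Qed.

Lemma unit_ball_volume_gt0 : (0 < n)%N -> 0 < unit_ball_volume R n.
Proof.
move=> n0; apply: fine_gt0; rewrite volume_ball_lty andbT.
have le_ball : (volume [set x : 'rV[R]_n | forall i, (`|x 0 i| <= n%:R^-1)%R] <=
    volume [set x : 'rV[R]_n | (enorm x <= 1)%R])%E.
  apply: le_measure; rewrite ?inE; [exact: mcube|exact: closed_ball_le1|].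
  by move=> x /= xn; exact: enorm_le1.
rewrite (lt_le_trans _ le_ball)// volume_cube ?invr_ge0// lte_fin exprn_gt0//.
by rewrite pmulrn_lgt0// invr_gt0 ltr0n.
Qed.

Lemma volume_point0 : (0 < n)%N -> volume [set 0 : 'rV[R]_n] = 0%E.
Proof.
move=> n0; rewrite (_ : [set (0 : 'rV[R]_n)] =
  [set x : 'rV[R]_n | forall i, `|x 0 i| <= 0]).
  by rewrite volume_cube// mul0rn expr0n gtn_eqF.
apply/seteqP; split => [_ -> i|x /= x0]; first by rewrite mxE normr0.
by apply/rowP => i; rewrite mxE; apply/eqP; rewrite -normr_le0.
Qed.

(** The cone over the sphere is the unit ball without its centre. *)
Lemma volume_cone_sphere : (0 < n)%N ->
  volume (cone (sphere : set 'rV[R]_n)) = (unit_ball_volume R n)%:E.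
Proof.
move=> n0; rewrite /unit_ball_volume fineK; last first.
  by rewrite ge0_fin_numE ?volume_ball_lty.
have m0 : measurable ([set 0] : set (borel_rV R n)).
  apply: measurable_closed.
  exact: (@accessible_closed_set1 _ (hausdorff_accessible (@norm_hausdorff _ _)) 0).
have mc : measurable (cone (sphere : set 'rV[R]_n) : set (borel_rV R n)).
  by apply: measurable_cone; apply: measurable_closed; exact: closed_sphere.
rewrite (_ : [set x : 'rV[R]_n | _] = cone sphere `|` [set 0]).
  rewrite measureU//=; first by rewrite volume_point0// adde0.
  apply/seteqP; split => // x [[/andP[+ _] _] x0].
  by rewrite /= x0 enorm_gt0 eqxx.
apply/seteqP; split => [x /= x1|x [[/andP[_]]//|->]]; last first.
  rewrite /=; apply: le_trans ler01.
  by rewrite leNgt enorm_gt0 eqxx.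
have [->|x0] := eqVneq x 0; [by right|left].
split; first by rewrite enorm_gt0 x0.
by rewrite /sphere /= enormZ ger0_norm ?invr_ge0 ?enorm_ge0// mulVf// gt_eqF// enorm_gt0.
Qed.

End volume_facts.

(** * Spherical Lebesgue measure *)

Section spherical_measure.
Context (R : realType) (n : nat).

Local Notation lebesgue_rV := (caratheodory_type (mu_ext (@sphere_borel R n))).
Local Notation sigma := (@sphere_measure R n).

Lemma lebesgue_rV_borel (A : set (borel_rV R n)) :
  measurable A -> measurable (A : set lebesgue_rV).
Proof. exact: caratheodory_measurable_mu_ext. Qed.

(** Completeness of the spherical measure. *)
Lemma lebesgue_rV_null (A B : set (borel_rV R n)) :
  measurable A -> sphere_borel A = 0%E -> B `<=` A -> measurable (B : set lebesgue_rV).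
Proof.
move=> mA A0 BA.
apply: (@measure_is_complete_caratheodory _ _ (mu_ext (@sphere_borel R n)) B).
exists A; split=> //; first exact: lebesgue_rV_borel.
by rewrite -A0; exact: measurable_mu_extE.
Qed.

Lemma sphere_measureE (A : set (borel_rV R n)) :
  measurable A -> sigma A = sphere_borel A.
Proof. exact: measurable_mu_extE. Qed.

Lemma sphere_measure_sphere : (0 < n)%N ->
  sigma sphere = (n%:R * unit_ball_volume R n)%:E.
Proof.
move=> n0; rewrite sphere_measureE; last first.
  by apply: measurable_closed; exact: closed_sphere.
by rewrite /sphere_borel volume_cone_sphere// EFinM.
Qed.

Lemma measurable_fun_lebesgue_rV d (U : measurableType d)
    (D : set (borel_rV R n)) (f : borel_rV R n -> U) :
  measurable D -> measurable_fun D f -> measurable_fun (D : set lebesgue_rV) f.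
Proof. by move=> mD mf _ Y mY; apply: lebesgue_rV_borel; exact: mf. Qed.

Lemma within_continuous_measurable_rV (D : set 'rV[R]_n) (f : 'rV[R]_n -> R) :
  closed D -> {within D, continuous f} ->
  measurable_fun (D : set (borel_rV R n)) (f : borel_rV R n -> R).
Proof.
move=> cD /continuousP cf; apply: (measurability _ (RGenOpens.measurableE R)).
move=> _ [_ [a [b ->] <-]].
have oab : open (`]a, b[%classic : set R) by exact: interval_open.
have /open_subspaceP[V oV VE] := cf _ oab.
rewrite setIC -VE; apply: measurableI; last exact: measurable_closed.
exact: measurable_open.
Qed.

End spherical_measure.

(** * The support function of a hull *)

Section hull_support.
Context (R : realType) (n : nat).
Variables (Omega : set 'rV[R]_n) (rho : 'rV[R]_n -> R).
Implicit Types (u x : 'rV[R]_n) (C : set 'rV[R]_n).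

Definition hull_support x : R := sup [set rho u * dot u x | u in Omega].

Definition maximizer x u : Prop :=
  Omega u /\ hull_support x <= rho u * dot u x.

Hypothesis Omega_compact : compact Omega.
Hypothesis rho_cont : {within Omega, continuous rho}.

(** Joint upper semicontinuity in the point and the direction, relative to Omega. *)
Lemma near_height_lt u x c : Omega u -> rho u * dot u x < c ->
  \forall u' \near u & x' \near x, Omega u' -> rho u' * dot u' x' < c.
Proof.
move=> Ou uxc.
have FO : ProperFilter (within Omega (nbhs u)).
  by apply: within_nbhs_proper; exact: subset_closure.
pose G := filter_prod (within Omega (nbhs u)) (nbhs x).
have h : (fun z => rho z.1 * dot z.1 z.2) @ G --> rho u * dot u x.
  apply: cvgM.
    apply: (cvg_comp _ _ cvg_fst).
    by move/subspace_continuousP : rho_cont; exact.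
  apply: cvg_dot; last exact: cvg_snd.
  by apply: cvg_trans cvg_fst _; exact: cvg_within.
have [[A B] /= [GA GB] AB] := h _ (lt_nbhsl uxc).
by exists ((fun u' => Omega u' -> A u'), B) => // -[u' x'] /= [Au' Bx'] Ou';
  apply: (AB (u', x')); split => //; exact: Au'.
Qed.

(** Tube lemma: on a compact set of points a strict bound persists for nearby
directions. *)
Lemma near_all_height_lt C x c : compact C -> C `<=` Omega ->
  (forall u, C u -> rho u * dot u x < c) ->
  \forall x' \near x, forall u, C u -> rho u * dot u x' < c.
Proof.
move=> /compact_near_coveringP/near_covering_withinP Ccov CO Cc.
apply: (Ccov _ (nbhs x) (fun x' u => rho u * dot u x' < c)) => u Cu.
have := near_height_lt (CO _ Cu) (Cc _ Cu).
by apply: filterS => -[u' x'] /= h Cu'; exact: h (CO _ Cu').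
Qed.

Lemma height_EVT_max C x : C !=set0 -> compact C -> C `<=` Omega ->
  exists2 u, C u & forall u', C u' -> rho u' * dot u' x <= rho u * dot u x.
Proof.
move=> C0 cC CO.
have [|u uC umax] := @compact_EVT_max _ R (fun u => rho u * dot u x) C C0 cC.
  apply: (continuous_subspaceW CO).
  apply/subspace_continuousP => u Ou; apply: cvgM.
    by move/subspace_continuousP : rho_cont; exact.
  apply: cvg_dot; last exact: cvg_cst.
  exact: cvg_within.
by exists u; [rewrite -inE|move=> u' u'C; apply: umax; rewrite inE].
Qed.

Hypothesis Omega0 : Omega !=set0.

Lemma hull_support_max x :
  exists2 u, Omega u & hull_support x = rho u * dot u x.
Proof.
have [u Ou umax] := height_EVT_max x Omega0 Omega_compact (@subset_refl _ _).
exists u => //; apply/eqP; rewrite eq_le; apply/andP; split.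
  apply: ge_sup; first by exists (rho u * dot u x), u.
  by move=> _ [u' Ou' <-]; exact: umax.
apply: ub_le_sup; last by exists u.
by exists (rho u * dot u x) => _ [u' Ou' <-]; exact: umax.
Qed.

Lemma hull_support_ub x u : Omega u -> rho u * dot u x <= hull_support x.
Proof.
move=> Ou; have [v Ov vmax] := height_EVT_max x Omega0 Omega_compact (@subset_refl _ _).
apply: ub_le_sup; last by exists u.
by exists (rho v * dot v x) => _ [u' Ou' <-]; exact: vmax.
Qed.

Lemma exists_maximizer x : exists u, maximizer x u.
Proof. by have [u Ou ux] := hull_support_max x; exists u; split; rewrite ?ux. Qed.

Lemma maximizerE x u : maximizer x u -> hull_support x = rho u * dot u x.
Proof. by move=> [Ou xu]; apply/eqP; rewrite eq_le xu hull_support_ub. Qed.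

Lemma continuous_hull_support : continuous hull_support.
Proof.
move=> x; apply/(@cvgrPdist_lt _ _ _ (nbhs x)) => e e0.
have near_ub : \forall x' \near x, forall u, Omega u ->
    rho u * dot u x' < hull_support x + e.
  apply: near_all_height_lt => // u Ou.
  by rewrite (le_lt_trans (hull_support_ub x Ou))// ltrDl.
have [u Ou xu] := hull_support_max x.
have near_lb : \forall x' \near x, hull_support x - e < rho u * dot u x'.
  have h : rho u * dot u x' @[x' --> x] --> rho u * dot u x.
    have cd : dot u x' @[x' --> x] --> dot u x.
      exact: (@cvg_dot _ _ _ (nbhs x) (cst u) id u x _ (cvg_cst u) (@cvg_id _ (nbhs x))).
    exact: (cvgM (cvg_cst (rho u)) cd).
  have xe : hull_support x - e < rho u * dot u x by rewrite xu ltrBlDr ltrDl.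
  exact: (h _ (lt_nbhsr xe)).
near=> x'.
have ub : hull_support x' < hull_support x + e.
  have [v Ov ->] := hull_support_max x'.
  by move: v Ov; near: x'.
have lb : hull_support x - e < hull_support x'.
  rewrite (@lt_le_trans _ _ (rho u * dot u x'))//; last exact: hull_support_ub.
  by near: x'.
by rewrite distrC ltr_distl lb ub.
Unshelve. all: by end_near. Qed.

(** A direction with no maximizer in C leaves a gap below h x on the compact set of
points of Omega in C; the gap persists for nearby directions. *)
Lemma closed_maximizer_in C : closed C ->
  closed [set x | exists2 u, C u & maximizer x u].
Proof.
move=> cC; rewrite -openC openE => x /= nx.
have cCO : compact (Omega `&` C).
  apply: (subclosed_compact _ Omega_compact); last exact: subIsetl.
  by apply: closedI => //; apply: compact_closed => //; exact: norm_hausdorff.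
have [c xc cx] : exists2 c, forall u, (Omega `&` C) u -> rho u * dot u x < c &
    c < hull_support x.
  have [OC0|OC0] := pselect ((Omega `&` C) !=set0); last first.
    exists (hull_support x - 1); last by rewrite ltrBlDr ltrDl.
    by move=> u OCu; exfalso; apply: OC0; exists u.
  have [u [Ou Cu] umax] := height_EVT_max x OC0 cCO (@subIsetl _ _ _).
  have ux : rho u * dot u x < hull_support x.
    by rewrite ltNge; apply/negP => ux; apply: nx; exists u.
  exists ((rho u * dot u x + hull_support x) / 2); last by rewrite midf_lt.
  by move=> v /umax vu; rewrite (le_lt_trans vu)// midf_lt.
have near1 := near_all_height_lt cCO (@subIsetl _ _ _) xc.
have near2 := continuous_hull_support (lt_nbhsr cx).
apply: filterS2 near1 near2 => x' x'c cx' [u Cu [Ou]].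
by rewrite leNgt (lt_trans (x'c _ _) cx').
Qed.

End hull_support.

(** * Directions with several maximizers are negligible *)

Section nonunique_maximizers.
Context (R : realType) (n : nat).
Variables (Omega : set 'rV[R]_n) (rho : 'rV[R]_n -> R).
Hypothesis Omega_compact : compact Omega.
Hypothesis Omega0 : Omega !=set0.
Hypothesis Omega_sphere : Omega `<=` sphere.
Hypothesis rho_cont : {within Omega, continuous rho}.
Hypothesis rho_gt0 : forall u, Omega u -> 0 < rho u.

Local Notation maximizer := (maximizer Omega rho).
Local Notation coordinate i u := (rho u * u 0 i).

(** The directions at which the partial derivatives of h from the left and from the
right along the i-th axis differ. *)
Definition kink (i : 'I_n) : set 'rV[R]_n :=
  [set x | exists u v,
     [/\ maximizer x u, maximizer x v & coordinate i u < coordinate i v]].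

(** The i-th coordinate of a maximizing point is a subgradient of a convex function
of one variable, hence monotone: add the two inequalities that express the
optimality of u and v. *)
Lemma maximizer_monotone i x u v s s' : s < s' ->
  maximizer (x + s *: delta_mx 0 i) u -> maximizer (x + s' *: delta_mx 0 i) v ->
  coordinate i u <= coordinate i v.
Proof.
move=> ss' mu mv.
have := mv.2; rewrite -subr_ge0.
have := hull_support_ub Omega_compact rho_cont Omega0 (x + s' *: delta_mx 0 i) mu.1.
have := hull_support_ub Omega_compact rho_cont Omega0 (x + s *: delta_mx 0 i) mv.1.
rewrite (maximizerE _ _ _ mu)// (maximizerE _ _ _ mv)// !dotDr !dotZr !dot_delta.
move=> h1 h2 _.
rewrite -subr_ge0 -(pmulr_rge0 _ (_ : 0 < s' - s)) ?subr_gt0//; lra.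
Qed.

(** By monotonicity the gaps between two maximizing coordinates at different points
of the line are disjoint; a rational chosen in each gap identifies the point. *)
Lemma countable_kink_line i x :
  countable [set s : R | kink i (x + s *: delta_mx 0 i)].
Proof.
have /choice[q qP] : forall s : R, exists q : rat,
    kink i (x + s *: delta_mx 0 i) ->
    exists u v, [/\ maximizer (x + s *: delta_mx 0 i) u,
      maximizer (x + s *: delta_mx 0 i) v &
      coordinate i u < ratr q < coordinate i v].
  move=> s; have [|k] := pselect (kink i (x + s *: delta_mx 0 i)); last by exists 0.
  move=> [u [v [mu mv uv]]]; have [q quv] := rat_in_itvoo uv.
  by exists q => _; exists u, v; split=> //; move: quv; rewrite in_itv.
apply/countable_injP; exists (pickle \o q) => s s' /set_mem ks /set_mem ks' /=.
move=> /(pcan_inj pickleK) qss'.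
wlog ss' : s s' ks ks' qss' / s < s'.
  move=> h; have [ss'|ss'|//] := ltgtP s s'; first exact: h.
  by apply/esym; exact: h.
have [u [v [_ mv /andP[_ qv]]]] := qP _ ks.
have [u' [v' [mu' _ /andP[u'q _]]]] := qP _ ks'.
have := maximizer_monotone ss' mv mu'; rewrite leNgt => /negP[].
by rewrite (lt_trans u'q)// -qss'.
Qed.

Lemma closed_within_le (f : 'rV[R]_n -> R) (a : R) :
  {within Omega, continuous f} -> closed [set u | Omega u /\ f u <= a].
Proof.
move=> cf x clx.
have cO : closed Omega by exact: (compact_closed (@norm_hausdorff _ _)).
have Ox : Omega x by apply: cO => B /clx[y [[Oy _] By]]; exists y.
split=> //; rewrite leNgt; apply/negP => ax.
have /subspace_continuousP/(_ _ Ox) fx := cf.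
have [y [[Oy ya] /(_ Oy) ay]] := clx _ (fx _ (lt_nbhsr ax)).
by rewrite /= ltNge ya in ay.
Qed.

(** Two different coordinates are separated by two rationals, which writes the set
as a countable union of closed sets. *)
Lemma measurable_kink i : measurable (kink i : set (borel_rV R n)).
Proof.
have cc : {within Omega, continuous (fun u => coordinate i u)}.
  apply/subspace_continuousP => u Ou; apply: cvgM.
    by move/subspace_continuousP : rho_cont; exact.
  apply: cvg_trans (@coord_continuous R _ _ 0 i u).
  exact: cvg_within_filter.
have ccN : {within Omega, continuous (fun u => - coordinate i u)}.
  apply/subspace_continuousP => u Ou; apply: cvgN.
  by move/subspace_continuousP : cc; exact.
pose B (p : rat * rat) : set 'rV[R]_n := if p.1 < p.2 then
  [set x | exists2 u, Omega u /\ coordinate i u <= ratr p.1 & maximizer x u] `&`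
  [set x | exists2 u, Omega u /\ - coordinate i u <= - ratr p.2 & maximizer x u]
  else set0.
have -> : kink i = \bigcup_p B p.
  apply/seteqP; split => [x [u [v [mu mv uv]]]|x [[q q'] _]]; last first.
    rewrite /B /=; case: ifPn => // qq' [[u [_ uq] mu] [v [_ vq'] mv]].
    exists u, v; split=> //; rewrite (le_lt_trans uq)//.
    by rewrite (lt_le_trans _ (_ : ratr q' <= _)) ?ltr_rat// -lerN2.
  have [q'] := rat_in_itvoo uv; rewrite in_itv/= => /andP[uq' q'v].
  have [q] := rat_in_itvoo uq'; rewrite in_itv/= => /andP[uq qq'].
  exists (q, q') => //; rewrite /B/= -(ltr_rat R) qq'; split.
    by exists u => //; split; [exact: mu.1|exact: ltW].
  by exists v => //; split; [exact: mv.1|rewrite lerN2; exact: ltW].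
apply: countable_bigcupT_measurable => // p; rewrite /B; case: ifPn => // _.
by apply: measurableI; apply: measurable_closed; apply: closed_maximizer_in => //;
  exact: closed_within_le.
Qed.

Definition kinks : set (borel_rV R n) := \big[setU/set0]_(i < n) kink i.

Lemma measurable_kinks : measurable (kinks : set (borel_rV R n)).
Proof.
rewrite /kinks; elim/big_ind : _ => //.
  by move=> A B mA mB; exact: (@measurableU _ (borel_rV R n)).
by move=> i _; exact: measurable_kink.
Qed.

Lemma volume_kinks : volume kinks = 0%E.
Proof.
apply/negligibleP; first exact: measurable_kinks.
rewrite /kinks; elim/big_ind : _ => //; first exact: negligible_set0.
  by move=> A B nA nB; exact: (@negligibleU _ (borel_rV R n)).
move=> i _; apply/negligibleP; first exact: measurable_kink.
apply: (volume_countable_lines (i := i)); first exact: measurable_kink.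
exact: countable_kink_line.
Qed.

(** Off the kinks two maximizers give the same point of P, and a point of P has the
direction of a unique element of Omega, as Omega lies on the sphere. *)
Lemma unique_maximizer x u v : ~ kinks x -> maximizer x u -> maximizer x v -> u = v.
Proof.
move=> kx mu mv.
have nk i : ~ kink i x.
  by move=> ki; apply: kx; rewrite /kinks (bigD1 i)//=; left.
have eqc : rho u *: u = rho v *: v.
  apply/rowP => i; rewrite !mxE; apply/eqP; rewrite eq_le !leNgt.
  by apply/andP; split; apply/negP => ?; apply: (nk i); [exists v, u|exists u, v].
have eqr : rho u = rho v.
  have := congr1 (@enorm R n) eqc; rewrite !enormZ !gtr0_norm ?rho_gt0 ?mu.1 ?mv.1//.
  - by rewrite (Omega_sphere mu.1) (Omega_sphere mv.1) !mulr1.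
  - exact: mv.1.
  - exact: mu.1.
apply: (scalerI (_ : rho u != 0)); first by rewrite gt_eqF// rho_gt0//; exact: mu.1.
by rewrite eqc eqr.
Qed.

Lemma maximizerZ a x u : 0 < a -> maximizer (a *: x) u <-> maximizer x u.
Proof.
have sub b y v : 0 < b -> maximizer y v -> maximizer (b *: y) v.
  move=> b0 mv; split; first exact: mv.1.
  have [w Ow ->] := hull_support_max Omega_compact rho_cont Omega0 (b *: y).
  rewrite !dotZr !(mulrCA _ b) ler_pM2l//.
  by rewrite (le_trans _ mv.2)// hull_support_ub.
move=> a0; split; last exact: sub.
move=> /(sub a^-1); rewrite scalerA mulVf ?gt_eqF// scale1r; apply.
by rewrite invr_gt0.
Qed.

Lemma kinksZ a x : 0 < a -> kinks (a *: x) -> kinks x.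
Proof.
move=> a0; rewrite /kinks; elim/big_ind : _ => //.
  by move=> A B hA hB [/hA|/hB] ?; [left|right].
move=> i _ [u [v [mu mv uv]]]; exists u, v.
by split=> //; apply/(maximizerZ _ _ a0).
Qed.

(** The cone over a dilation-invariant set is contained in the set, so zero volume
is zero spherical measure. *)
Lemma sphere_borel_kinks : sphere_borel kinks = 0%E.
Proof.
rewrite /sphere_borel (_ : volume (cone kinks) = 0%E) ?mule0//.
apply/eqP; rewrite -measure_le0 -volume_kinks; apply: le_measure; rewrite ?inE.
- by apply: measurable_cone; exact: measurable_kinks.
- exact: measurable_kinks.
- by move=> x [/andP[x0 _]]; apply: kinksZ; rewrite invr_gt0.
Qed.

End nonunique_maximizers.

(** * The derivative of the logarithm of the support function *)

Lemma compact_bounded_within (R : realType) (T : topologicalType) (A : set T)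
    (f : T -> R) :
  compact A -> {within A, continuous f} ->
  exists M : R, forall x, A x -> `|f x| <= M.
Proof.
move=> cA cf.
have [A0|A0] := pselect (A !=set0); last first.
  by exists 0 => x Ax; exfalso; apply: A0; exists x.
have cn : {within A, continuous (fun x => `|f x|)}.
  apply/subspace_continuousP => x Ax; apply: cvg_norm.
  by move/subspace_continuousP : cf; exact.
have [x _ xmax] := compact_EVT_max A0 cA cn.
by exists `|f x| => y Ay; apply: xmax; rewrite inE.
Qed.

Section maximizer_gap.
Context (R : realType) (n : nat).
Variables (Omega : set 'rV[R]_n) (rho : 'rV[R]_n -> R).
Hypothesis Omega_compact : compact Omega.
Hypothesis Omega0 : Omega !=set0.
Hypothesis rho_cont : {within Omega, continuous rho}.

(** Where f differs from f u by e or more, the heights stay below h x by a fixed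
amount, by compactness. Used with f = g for the envelope principle and with a
linear form for the normals of the polar body. *)
Lemma maximizer_gap x u (f : 'rV[R]_n -> R) e : 0 < e ->
  {within Omega, continuous f} ->
  (forall v, maximizer Omega rho x v -> v = u) ->
  exists2 c, c < hull_support Omega rho x &
    forall v, Omega v -> `|f v - f u| < e \/ rho v * dot v x <= c.
Proof.
move=> e0 cf uniq.
pose C := [set v | Omega v /\ - `|f v - f u| <= - e].
have CO : C `<=` Omega by move=> v [].
have cC : compact C.
  apply: subclosed_compact Omega_compact CO.
  apply: closed_within_le => //; apply/subspace_continuousP => v Ov.
  apply: cvgN; apply: cvg_norm; apply: cvgB; last exact: cvg_cst.
  by move/subspace_continuousP : cf; exact.
have dich v c : Omega v -> (C v -> rho v * dot v x <= c) ->
    `|f v - f u| < e \/ rho v * dot v x <= c.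
  move=> Ov h; have [|ev] := ltP `|f v - f u| e; first by left.
  by right; apply: h; split => //; rewrite lerN2.
have [C0|C0] := pselect (C !=set0); last first.
  exists (hull_support Omega rho x - 1); first by rewrite ltrBlDr ltrDl.
  by move=> v Ov; apply: dich => // Cv; exfalso; apply: C0; exists v.
have [w [Ow we] wmax] := height_EVT_max rho_cont x C0 cC CO.
exists (rho w * dot w x); last by move=> v Ov; apply: dich => //; exact: wmax.
rewrite ltNge; apply/negP => xw; move: we.
by rewrite (uniq w) ?subrr ?normr0 ?oppr0 ?oppr_ge0 ?leNgt ?e0.
Qed.

End maximizer_gap.

Section hull_support_comparison.
Context (R : realType) (n : nat).
Variables (Omega : set 'rV[R]_n).
Hypothesis Omega_compact : compact Omega.
Hypothesis Omega0 : Omega !=set0.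
Implicit Types rho : 'rV[R]_n -> R.

Lemma hull_support_gt0 rho x u : {within Omega, continuous rho} ->
  (forall u, Omega u -> 0 < rho u) -> Omega u -> 0 < dot u x ->
  0 < hull_support Omega rho x.
Proof.
move=> cr r0 Ou ux.
by rewrite (lt_le_trans _ (hull_support_ub Omega_compact cr Omega0 x Ou))// mulr_gt0 ?r0.
Qed.

(** Only the points with dot u x > 0 matter, because the right-hand side is
positive. *)
Lemma hull_support_le rho rho' x c : {within Omega, continuous rho} ->
  {within Omega, continuous rho'} ->
  0 < hull_support Omega rho x ->
  (forall u, Omega u -> 0 < rho' u) ->
  (forall u, Omega u -> 0 < dot u x ->
    rho' u * dot u x <= hull_support Omega rho x * expR c) ->
  hull_support Omega rho' x <= hull_support Omega rho x * expR c.
Proof.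
move=> cr cr' h0 r'0 h.
have [u Ou ->] := hull_support_max Omega_compact cr' Omega0 x.
have [ux|ux] := ltP 0 (dot u x); first exact: h.
rewrite (@le_trans _ _ 0)//; first by rewrite pmulr_rle0// r'0.
by rewrite mulr_ge0 ?expR_ge0// ltW.
Qed.

End hull_support_comparison.

Section logarithmic_derivative.
Context (R : realType) (n : nat).
Variables (Omega : set 'rV[R]_n) (rho : R -> 'rV[R]_n -> R) (g : 'rV[R]_n -> R).
Hypothesis Omega_compact : compact Omega.
Hypothesis Omega0 : Omega !=set0.
Hypothesis g_cont : {within Omega, continuous g}.
Hypothesis rho_near : \forall t \near (0 : R),
  {within Omega, continuous (rho t)} /\ forall u, Omega u -> 0 < rho t u.
Hypothesis rho_log : forall e : R, 0 < e -> \forall t \near (0 : R),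
  forall u, Omega u -> `|ln (rho t u) - ln (rho 0 u) - t * g u| <= e * `|t|.

Local Notation h t x := (hull_support Omega (rho t) x).

Let rho0_cont : {within Omega, continuous (rho 0)}.
Proof. by have [] := nbhs_singleton rho_near. Qed.

Let rho0_gt0 u : Omega u -> 0 < rho 0 u.
Proof. by have [_] := nbhs_singleton rho_near; exact. Qed.

Let g_bounded : exists2 M : R, 0 <= M & forall u, Omega u -> `|g u| <= M.
Proof.
have [M gM] := compact_bounded_within Omega_compact g_cont.
by exists `|M| => // u Ou; exact: le_trans (gM u Ou) (ler_norm M).
Qed.

Let expR_ln_ratio (a b : R) : 0 < a -> 0 < b -> a = b * expR (ln a - ln b).
Proof.
move=> a0 b0; rewrite expRD expRN !lnK ?posrE// mulrCA.
by rewrite mulfV ?mulr1 ?gt_eqF.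
Qed.

(** Multiplying every rho u by a factor between exp (- c) and exp c multiplies h by
such a factor, whatever the direction. Hence M does not depend on x. *)
Lemma ln_hull_support_lipschitz : exists M : R, \forall t \near (0 : R),
  forall x u, Omega u -> 0 < dot u x ->
    `|ln (h t x) - ln (h 0 x)| <= M * `|t|.
Proof.
have [M M0 gM] := g_bounded; exists (M + 1).
near=> t; move=> x u Ou ux.
have [rt_cont rt_gt0] : {within Omega, continuous (rho t)} /\
  forall u, Omega u -> 0 < rho t u by near: t.
have diff v : Omega v -> `|ln (rho t v) - ln (rho 0 v)| <= (M + 1) * `|t|.
  move=> Ov; rewrite -[X in `|X|](subrK (t * g v)) (le_trans (ler_normD _ _))//.
  rewrite mulrDl addrC lerD//; first by rewrite normrM mulrC ler_wpM2r// gM.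
  by move: v Ov; near: t; exact: rho_log.
have ht0 := hull_support_gt0 Omega_compact Omega0 rt_cont rt_gt0 Ou ux.
have h00 := hull_support_gt0 Omega_compact Omega0 rho0_cont rho0_gt0 Ou ux.
have ub : h t x <= h 0 x * expR ((M + 1) * `|t|).
  apply: hull_support_le => // v Ov vx.
  rewrite [X in X * _ <= _](expR_ln_ratio (rt_gt0 _ Ov) (rho0_gt0 Ov)) mulrAC.
  rewrite ler_pM ?expR_ge0//.
  - by rewrite mulr_ge0// ltW// rho0_gt0.
  - exact: hull_support_ub.
  - by rewrite ler_expR (le_trans (ler_norm _))// diff.
have lb : h 0 x <= h t x * expR ((M + 1) * `|t|).
  apply: hull_support_le => // v Ov vx.
  rewrite [X in X * _ <= _](expR_ln_ratio (rho0_gt0 Ov) (rt_gt0 _ Ov)) mulrAC.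
  rewrite ler_pM ?expR_ge0//.
  - by rewrite mulr_ge0// ltW// rt_gt0.
  - exact: hull_support_ub.
  - by rewrite ler_expR (le_trans (ler_norm _))// distrC diff.
have expK a b : 0 < a -> 0 < b -> a <= b * expR ((M + 1) * `|t|) ->
    ln a - ln b <= (M + 1) * `|t|.
  move=> a0 b0; rewrite -ler_ln ?posrE ?mulr_gt0 ?expR_gt0// => /le_trans.
  by rewrite lnM ?posrE ?expR_gt0// expRK lerBlDl; apply.
by rewrite ler_norml lerNl opprB !expK.
Unshelve. all: by end_near. Qed.

(** Envelope principle. The lower bound on h_t x comes from u alone. For the upper
bound, the points v with g v close to g u change at the same rate as u, and the
others start at a height of at most c < h_0 x, so they cannot catch up for small
t. *)
Lemma cvg_ln_hull_support x u : Omega u -> 0 < dot u x ->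
  maximizer Omega (rho 0) x u ->
  (forall v, maximizer Omega (rho 0) x v -> v = u) ->
  (ln (h t x) - ln (h 0 x)) / t @[t --> 0^'] --> g u.
Proof.
move=> Ou ux mu uniq.
have [M M0 gM] := g_bounded.
have h00 := hull_support_gt0 Omega_compact Omega0 rho0_cont rho0_gt0 Ou ux.
have huE := maximizerE Omega_compact rho0_cont Omega0 mu.
suff H (e : R) : 0 < e -> \forall t \near (0 : R),
    `|ln (h t x) - ln (h 0 x) - t * g u| <= e * `|t|.
  apply/(@cvgrPdist_le _ R^o) => e e0.
  have He := H e e0.
  near=> t.
  have t0 : t != 0 by near: t; exact: nbhs_dnbhs_neq.
  rewrite -(ler_pM2r (_ : 0 < `|t|)) ?normr_gt0// -normrM mulrBl divfK//.
  rewrite distrC mulrC; near: t; exact: nbhs_dnbhs.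
move=> e0; have e20 : 0 < e / 2 by rewrite divr_gt0.
have [c ch gap] := maximizer_gap Omega_compact rho0_cont e20 g_cont uniq.
(* M + M + 1: the height c may grow at rate M + 1 while the target may shrink
   at rate M. *)
have small : \forall t \near (0 : R), c * expR ((M + M + 1) * `|t|) < h 0 x.
  have : c * expR ((M + M + 1) * `|t|) @[t --> (0 : R)] --> c * expR ((M + M + 1) * `|0 : R|).
    apply: cvgM; first exact: cvg_cst.
    apply: continuous_cvg; first exact: continuous_expR.
    by apply: cvgM; [exact: cvg_cst|exact: (@norm_continuous _ R^o)].
  rewrite normr0 mulr0 expR0 mulr1 => cc.
  exact: (cc _ (lt_nbhsl ch)).
near=> t.
have [rt_cont rt_gt0] : {within Omega, continuous (rho t)} /\
  forall u, Omega u -> 0 < rho t u by near: t.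
have half v : Omega v -> `|ln (rho t v) - ln (rho 0 v) - t * g v| <= e / 2 * `|t|.
  by move: v; near: t; exact: rho_log.
have one v : Omega v -> `|ln (rho t v) - ln (rho 0 v) - t * g v| <= 1 * `|t|.
  by move: v; near: t; exact: rho_log.
have ht0 := hull_support_gt0 Omega_compact Omega0 rt_cont rt_gt0 Ou ux.
have ub : h t x <= h 0 x * expR (t * g u + e * `|t|).
  apply: hull_support_le => // v Ov vx.
  rewrite [X in X * _ <= _](expR_ln_ratio (rt_gt0 _ Ov) (rho0_gt0 Ov)) mulrAC.
  have [guv|hc] := gap v Ov.
    rewrite ler_pM ?expR_ge0//.
    - by rewrite mulr_ge0// ltW// rho0_gt0.
    - exact: hull_support_ub.
    rewrite ler_expR.
    have tg : t * g v <= t * g u + e / 2 * `|t|.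
      rewrite -lerBlDl -mulrBr (le_trans (ler_norm _))// normrM mulrC.
      by rewrite ler_wpM2r// ltW.
    by have := half v Ov; rewrite ler_norml => /andP[_]; lra.
  have tg : - (M * `|t|) <= t * g u.
    rewrite lerNl (le_trans (ler_norm _))// normrN normrM mulrC.
    by rewrite ler_wpM2r// gM.
  have c0 : 0 < c by rewrite (lt_le_trans _ hc)// mulr_gt0 ?rho0_gt0.
  apply: (@le_trans _ _ (c * expR ((M + 1) * `|t|))).
    rewrite ler_pM ?expR_ge0//; first by rewrite mulr_ge0// ltW// rho0_gt0.
    rewrite ler_expR.
    have tgv : t * g v <= M * `|t|.
      by rewrite (le_trans (ler_norm _))// normrM mulrC ler_wpM2r// gM.
    by have := one v Ov; rewrite ler_norml => /andP[_]; lra.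
  apply: (@le_trans _ _ (h 0 x * expR (- (M * `|t|)))); last first.
    rewrite ler_pM2l// ler_expR.
    by have := mulr_ge0 (ltW e0) (normr_ge0 t); lra.
  rewrite expRN ler_pdivlMr ?expR_gt0// -mulrA -expRD.
  rewrite (_ : _ + _ = (M + M + 1) * `|t|); last by ring.
  by apply: ltW; near: t.
have lb : h 0 x * expR (t * g u - e * `|t|) <= h t x.
  rewrite (le_trans _ (hull_support_ub Omega_compact rt_cont Omega0 x Ou))//.
  rewrite [X in _ <= X * _](expR_ln_ratio (rt_gt0 _ Ou) (rho0_gt0 Ou)) mulrAC -huE.
  rewrite ler_pM2l// ler_expR.
  have := half u Ou; rewrite ler_norml => /andP[+ _].
  have := mulr_ge0 (ltW e20) (normr_ge0 t); lra.
have ub' : ln (h t x) <= ln (h 0 x) + (t * g u + e * `|t|).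
  by rewrite -ler_expR expRD !lnK ?posrE.
have lb' : ln (h 0 x) + (t * g u - e * `|t|) <= ln (h t x).
  by rewrite -ler_expR expRD !lnK ?posrE.
rewrite ler_norml; apply/andP; split; lra.
Unshelve. all: by end_near. Qed.

End logarithmic_derivative.

(** * The polar body of a hull *)

Section polar_of_hull.
Context (R : realType) (n : nat).
Variables (Omega : set 'rV[R]_n) (rho : 'rV[R]_n -> R).
Hypothesis Omega_compact : compact Omega.
Hypothesis Omega0 : Omega !=set0.
Hypothesis Omega_sphere : Omega `<=` sphere.
Hypothesis Omega_pos : forall x : 'rV[R]_n, x != 0 -> exists2 u, Omega u & 0 < dot u x.
Hypothesis rho_cont : {within Omega, continuous rho}.
Hypothesis rho_gt0 : forall u, Omega u -> 0 < rho u.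

Local Notation K' := (polar (hull_of Omega rho)).
Local Notation h := (hull_support Omega rho).

(** Half-spaces are convex, so the polar sees P only. *)
Lemma polar_hullP x : K' x <-> forall u, Omega u -> rho u * dot u x <= 1.
Proof.
split=> [Kx u Ou|H y].
  rewrite -dotZl dotC; apply: Kx.
  apply: (@sub_smallest _ _ _ [set rho u *: u | u in Omega]) => //.
  by exists u.
pose D : set 'rV[R]_n := [set y | dot x y <= 1].
suff : hull_of Omega rho `<=` D by exact.
apply: smallest_sub => [|_ [u Ou <-]]; last by rewrite /D/= dotC dotZl H.
move=> a b l; rewrite !inE /D/= => a1 b1.
rewrite [X in dot x X](_ : _ = l%:num *: (a : 'rV[R]_n) + (1 - l%:num) *: (b : 'rV[R]_n))//.
rewrite dotDr !dotZr -[leRHS](subrK l%:num) addrC lerD//.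
  by rewrite -[leRHS]mulr1 ler_wpM2l.
by rewrite -[leRHS]mulr1 ler_wpM2l// subr_ge0.
Qed.

Lemma hull_supportZ a x : 0 < a -> h (a *: x) = a * h x.
Proof.
move=> a0; have [u mu] := exists_maximizer Omega_compact rho_cont Omega0 x.
have mau : maximizer Omega rho (a *: x) u by apply/maximizerZ.
rewrite (maximizerE Omega_compact rho_cont Omega0 mau).
by rewrite (maximizerE Omega_compact rho_cont Omega0 mu) dotZr mulrCA.
Qed.

Lemma hull_support_pos x : x != 0 -> 0 < h x.
Proof. by move=> /Omega_pos[u Ou ux]; apply: hull_support_gt0 Ou ux. Qed.

Lemma sphere_neq0 (x : 'rV[R]_n) : sphere x -> x != 0.
Proof. by move=> x1; rewrite -enorm_gt0 (_ : enorm x = 1)// ltr01. Qed.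

Lemma polar_boundary x : x != 0 -> K' ((h x)^-1 *: x).
Proof.
move=> x0; apply/polar_hullP => u Ou; rewrite dotZr mulrCA mulrC.
by rewrite ler_pdivrMr ?hull_support_pos// mul1r hull_support_ub.
Qed.

(** The boundary point of the polar in the direction x is x / h x. *)
Lemma radial_polar_hull x : x != 0 -> radial K' x = (h x)^-1.
Proof.
move=> x0; have hx := hull_support_pos x0.
apply/eqP; rewrite eq_le /radial; apply/andP; split.
  apply: ge_sup; first by exists (h x)^-1; exact: polar_boundary.
  move=> l /= /polar_hullP Kl.
  have [u Ou hu] := hull_support_max Omega_compact rho_cont Omega0 x.
  by rewrite -[leRHS]mul1r ler_pdivlMr// hu -mulrCA -dotZr Kl.
apply: ub_le_sup; last exact: polar_boundary.
exists (h x)^-1 => l /= /polar_hullP Kl.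
have [u Ou hu] := hull_support_max Omega_compact rho_cont Omega0 x.
by rewrite -[leRHS]mul1r ler_pdivlMr// hu -mulrCA -dotZr Kl.
Qed.

Lemma hull_support_sphere_bounds : (0 < n)%N -> exists m M : R, 0 < m /\
  forall x, sphere x -> m <= h x <= M.
Proof.
move=> n0.
have [e e1] : exists e : 'rV[R]_n, sphere e.
  have [u /Omega_sphere u1] := Omega0; by exists u.
have S0 : (sphere : set 'rV[R]_n) !=set0 by exists e.
have ch : {within sphere, continuous h}.
  by apply: continuous_subspaceT; exact: continuous_hull_support.
have [a a1 amin] := compact_EVT_min S0 (@compact_sphere R n) ch.
have [b b1 bmax] := compact_EVT_max S0 (@compact_sphere R n) ch.
rewrite inE in a1; exists (h a), (h b); split.
  exact/hull_support_pos/sphere_neq0.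
by move=> x x1; rewrite amin ?bmax ?inE.
Qed.

(** Boundedness makes the suprema in the support function of the polar meaningful. *)
Lemma polar_hull_bounded : (0 < n)%N ->
  exists B : R, forall x v, K' x -> sphere v -> dot x v <= B.
Proof.
move=> n0; have [m [M [m0 mh]]] := hull_support_sphere_bounds n0.
exists (n%:R * m^-1) => x v Kx v1.
have xm : enorm x <= m^-1.
  have [->|x0] := eqVneq x 0.
    rewrite (@le_trans _ _ 0) ?invr_ge0 ?(ltW m0)//.
    by rewrite leNgt enorm_gt0 eqxx.
  have nx : 0 < enorm x by rewrite enorm_gt0.
  have y1 : sphere ((enorm x)^-1 *: x).
    by rewrite /sphere/= enormZ gtr0_norm ?invr_gt0// mulVf// gt_eqF.
  have /andP[my _] := mh _ y1.
  rewrite -[leRHS]mul1r ler_pdivlMr//.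
  have hx1 : h x <= 1.
    have [u Ou ->] := hull_support_max Omega_compact rho_cont Omega0 x.
    by move/polar_hullP : Kx; exact.
  rewrite (le_trans _ hx1)//.
  have nx0 : enorm x != 0 by rewrite gt_eqF.
  rewrite -[in leRHS](scale1r x) -(divff nx0) -scalerA hull_supportZ//.
  by rewrite ler_pM2l.
apply: (@le_trans _ _ (\sum_(i < n) m^-1)); last by rewrite sumr_const card_ord -[leLHS]mulr_natl.
apply: ler_sum => i _; rewrite (le_trans (ler_norm _))// normrM -[leRHS]mulr1.
rewrite ler_pM// ?(le_trans (normr_coord_enorm _ _))//.
by rewrite v1.
Qed.

(** At the boundary point x0 = u / h u of the polar only the constraint given by w is
active, so w is the only outer unit normal. If v were another one, moving from x0
in the direction v - w would decrease the active constraint, stay inside the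
polar for a short time, and increase the scalar product with v. *)
Lemma reverse_radial_gauss_imageP eta u w : (0 < n)%N -> sphere u ->
  maximizer Omega rho u w ->
  (forall v, maximizer Omega rho u v -> v = w) ->
  reverse_radial_gauss_image K' eta u <-> eta w.
Proof.
move=> n0 u1 mw uniq.
have u0 := sphere_neq0 u1.
have hu0 := hull_support_pos u0.
have w1 : sphere w by apply: Omega_sphere; exact: mw.1.
have rw0 : 0 < rho w by apply: rho_gt0; exact: mw.1.
have huE := maximizerE Omega_compact rho_cont Omega0 mw.
have Kx0 := polar_boundary u0.
rewrite /reverse_radial_gauss_image /support_hyperplane /radial_map /= radial_polar_hull//.
rewrite /support_function; set x0 := (h u)^-1 *: u in Kx0 *.
split=> [[_ [v [v1 etav] x0v]]|etaw]; last first.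
  split=> //; exists w => //.
  have x0w : dot x0 w = (rho w)^-1.
    have wu0 : dot w u != 0 by move: hu0; rewrite huE pmulr_rgt0// => /gt_eqF ->.
    by rewrite dotZl huE (dotC u) invfM -mulrA mulVf ?mulr1.
  have Kw x : K' x -> dot x w <= (rho w)^-1.
    move=> /polar_hullP/(_ _ mw.1); rewrite dotC => ?.
    by rewrite -[leRHS]mul1r ler_pdivlMr// mulrC.
  apply/eqP; rewrite eq_le; apply/andP; split.
    apply: ub_le_sup; last by exists x0.
    by exists (rho w)^-1 => _ [x Kx <-]; exact: Kw.
  rewrite x0w; apply: ge_sup; first by exists (dot x0 w), x0.
  by move=> _ [x Kx <-]; exact: Kw.
suff <- : v = w by [].
apply/eqP/negPn/negP => vw.
pose e := 1 - dot w v.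
have e0 : 0 < e by rewrite subr_gt0 dot_sphere_lt1// eq_sym.
pose d := v - w.
have cd : {within Omega, continuous (fun z => dot z d)}.
  apply: continuous_subspaceT => z.
  exact: (@cvg_dot _ _ _ (nbhs z) id (cst d) z d _ (@cvg_id _ (nbhs z)) (cvg_cst d)).
have wd : dot w d = - e.
  by rewrite dotDr dotNr -[dot w w]sqr_enorm w1 expr1n /e; ring.
have [c ch gap] := maximizer_gap Omega_compact rho_cont e0 cd uniq.
(* h d bounds the speed of every constraint in the direction d, and 1 - c / h u
   is the slack of those that do not already decrease. *)
pose s := (1 - c / h u) / (`|h d| + 1).
have chu : c / h u < 1 by rewrite ltr_pdivrMr// mul1r.
have hd1 : 0 < `|h d| + 1 by rewrite ltr_wpDl.
have s0 : 0 < s by rewrite divr_gt0// subr_gt0.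
have Kxs : K' (x0 + s *: d).
  apply/polar_hullP => z Oz; rewrite dotDr !dotZr mulrDr.
  have zx0 : rho z * ((h u)^-1 * dot z u) = rho z * dot z u / h u by ring.
  have [zd|zc] := gap z Oz.
    rewrite -[leRHS]addr0 lerD//.
      by rewrite zx0 ler_pdivrMr// mul1r hull_support_ub.
    rewrite pmulr_rle0 ?rho_gt0// pmulr_rle0//.
    by move: zd; rewrite wd ltr_norml => /andP[_]; lra.
  rewrite zx0 (@le_trans _ _ (c / h u + s * (`|h d| + 1)))//; last first.
    by rewrite divfK ?gt_eqF//; lra.
  rewrite lerD ?ler_pM2r ?invr_gt0// mulrCA ler_pM2l//.
  rewrite (le_trans (hull_support_ub Omega_compact rho_cont Omega0 d Oz))//.
  by rewrite (le_trans (ler_norm _))// lerDl.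
have [B KB] := polar_hull_bounded n0.
have : dot (x0 + s *: d) v <= dot x0 v.
  rewrite x0v; apply: ub_le_sup; last by exists (x0 + s *: d).
  by exists B => _ [x Kx <-]; exact: KB.
apply/negP; rewrite -ltNge dotDl ltrDl dotZl mulr_gt0//.
by rewrite dotDl dotNl -[dot v v]sqr_enorm v1 expr1n.
Qed.

End polar_of_hull.

(** * The dual curvature measure as an image measure *)

Lemma continuous_expRM (R : realType) (a : R) : continuous (fun r : R => expR (a * r)).
Proof.
by move=> r; apply: continuous_comp; [exact: mulrl_continuous|exact: continuous_expR].
Qed.

Section sphere_integrals.
Context (R : realType) (n : nat).
Hypothesis n_gt0 : (0 < n)%N.
Local Notation lebesgue_rV := (caratheodory_type (mu_ext (@sphere_borel R n))).
Local Notation sigma := (@sphere_measure R n).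

Lemma measurable_sphere : measurable (sphere : set lebesgue_rV).
Proof. by apply: lebesgue_rV_borel; apply: measurable_closed; exact: closed_sphere. Qed.

Lemma sphere_measure_lty : (sigma sphere < +oo)%E.
Proof. by rewrite sphere_measure_sphere// ltry. Qed.

Lemma measurable_fun_sphere (f : 'rV[R]_n -> R) : {within sphere, continuous f} ->
  measurable_fun (sphere : set lebesgue_rV) (f : lebesgue_rV -> R).
Proof.
move=> cf; apply: measurable_fun_lebesgue_rV.
  by apply: measurable_closed; exact: closed_sphere.
by apply: within_continuous_measurable_rV => //; exact: closed_sphere.
Qed.

Lemma sphere_bounded (f : 'rV[R]_n -> R) : {within sphere, continuous f} ->
  exists M : R, forall v, sphere v -> `|f v| <= M.
Proof. by apply: compact_bounded_within; exact: compact_sphere. Qed.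

Lemma bounded_integrable_sphere (f : lebesgue_rV -> R) (M : R) :
  measurable_fun (sphere : set lebesgue_rV) f -> (forall v, sphere v -> `|f v| <= M) ->
  sigma.-integrable sphere (EFin \o f).
Proof.
move=> mf fM; apply: measurable_bounded_integrable => //.
- exact: measurable_sphere.
- exact: sphere_measure_lty.
exists M; split; first exact: num_real.
by move=> N MN v /= v1; rewrite (le_trans (fM v v1))// ltW.
Qed.

Lemma continuous_integrable_sphere (f : 'rV[R]_n -> R) :
  {within sphere, continuous f} ->
  sigma.-integrable sphere (EFin \o (f : lebesgue_rV -> R)).
Proof.
move=> cf; have [M fM] := sphere_bounded cf.
exact: bounded_integrable_sphere (measurable_fun_sphere cf) fM.
Qed.

End sphere_integrals.

Section dual_curvature_of_polar.
Context (R : realType) (n : nat).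
Variables (Omega : set 'rV[R]_n) (rho g : 'rV[R]_n -> R) (q : R).
Hypothesis n_gt0 : (0 < n)%N.
Hypothesis Omega_compact : compact Omega.
Hypothesis Omega0 : Omega !=set0.
Hypothesis Omega_sphere : Omega `<=` sphere.
Hypothesis Omega_pos : forall x : 'rV[R]_n, x != 0 -> exists2 u, Omega u & 0 < dot u x.
Hypothesis rho_cont : {within Omega, continuous rho}.
Hypothesis rho_gt0 : forall u, Omega u -> 0 < rho u.
Hypothesis g_cont : {within Omega, continuous g}.

Local Notation lebesgue_rV := (caratheodory_type (mu_ext (@sphere_borel R n))).
Local Notation sigma := (@sphere_measure R n).
Local Notation K' := (polar (hull_of Omega rho)).
Local Notation h := (hull_support Omega rho).
Local Notation N := (kinks Omega rho).

(** Outside the kinks this is the outer unit normal of the polar body at its boundary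
point in the direction x. On the kinks an arbitrary choice is made; completeness
of the spherical measure absorbs it. *)
Definition normal_direction (x : lebesgue_rV) : borel_rV R n :=
  get (maximizer Omega rho x).
Local Notation tau := normal_direction.

Lemma normal_directionP x : maximizer Omega rho x (tau x).
Proof.
have := @getPex _ (maximizer Omega rho x).
apply; exact: exists_maximizer.
Qed.

Lemma normal_direction_unique x u : ~ N x -> maximizer Omega rho x u -> u = tau x.
Proof. by move=> Nx mu; apply: unique_maximizer Nx mu (normal_directionP x). Qed.

Lemma measurable_sub_kinks (B : set lebesgue_rV) : B `<=` N -> measurable B.
Proof.
apply: lebesgue_rV_null; first exact: measurable_kinks.
exact: sphere_borel_kinks.
Qed.

Lemma sphere_measure_kinks : sigma N = 0%E.
Proof. by rewrite sphere_measureE ?sphere_borel_kinks//; exact: measurable_kinks. Qed.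

(** Up to a subset of the negligible kinks, the preimage of a closed set C is the
closed set of directions with a maximizer in C. *)
Lemma measurable_normal_direction : measurable_fun setT tau.
Proof.
apply: (@measurability _ _ lebesgue_rV (borel_rV R n) _ tau (@open 'rV[R]_n) erefl).
move=> _ [U oU <-]; rewrite setTI; pose C : set 'rV[R]_n := ~` U.
have -> : tau @^-1` U = ~` (tau @^-1` C).
  by apply/seteqP; split => x /=; rewrite /C /setC /=; [move=> ? ?|move/contrapT].
have cC : closed C by rewrite /C closedC.
apply: measurableC.
have -> : tau @^-1` C =
    ([set x | exists2 u, C u & maximizer Omega rho x u] `\` N) `|`
    (tau @^-1` C `&` N).
  apply/seteqP; split => x.
    have [Nx|Nx] := pselect (N x); first by right.
    by move=> Ux; left; split => //; exists (tau x) => //; exact: normal_directionP.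
  by move=> [[[u Uu mu] Nx]|[]//]; rewrite /preimage /= -(normal_direction_unique Nx mu).
apply: measurableU; last by apply: measurable_sub_kinks; exact: subIsetr.
apply: measurableD; last exact: measurable_sub_kinks.
by apply: lebesgue_rV_borel; apply: measurable_closed; exact: closed_maximizer_in.
Qed.

Lemma hull_support_continuous_comp (phi : R -> R) : continuous phi ->
  {within sphere, continuous (fun v => phi (ln (h v)))}.
Proof.
move=> cphi; apply: continuous_in_subspaceT => v; rewrite inE => v1.
have hv : 0 < h v by apply: hull_support_pos => //; exact: sphere_neq0.
apply: continuous_comp; last exact: cphi.
apply: continuous_comp; last exact: continuous_ln.
exact: continuous_hull_support.
Qed.

Local Notation W := (fun v : lebesgue_rV => expR (- q * ln (h v))).

Let W_cont : {within sphere, continuous (W : 'rV[R]_n -> R)}.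
Proof.
exact: (hull_support_continuous_comp (@continuous_expRM _ (- q))).
Qed.

Lemma radial_powR v (p : R) : sphere v -> radial K' v `^ p = expR (- p * ln (h v)).
Proof.
move=> v1; have v0 := sphere_neq0 v1.
have hv : 0 < h v by apply: hull_support_pos.
by rewrite radial_polar_hull// /powR gt_eqF ?invr_gt0// lnV ?posrE// mulrN mulNr.
Qed.

Let w : lebesgue_rV -> R := (fun v => n%:R^-1 * W v) \_ sphere.

Let w_ge0 v : 0 <= w v.
Proof. by rewrite /w patchE; case: ifPn => // _; rewrite mulr_ge0 ?invr_ge0 ?expR_ge0. Qed.

Let measurable_w : measurable_fun setT w.
Proof.
apply/(measurable_restrictT _ _).1; first exact: measurable_sphere.
apply: measurable_fun_sphere.
apply: (hull_support_continuous_comp (phi := fun r => n%:R^-1 * expR (- q * r))) => r.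
apply: (@continuous_comp _ _ _ (fun r => expR (- q * r)) ( *%R n%:R^-1)).
  exact: continuous_expRM.
exact: mulrl_continuous.
Qed.

Local Notation nu := (pushforward_density sigma measurable_normal_direction measurable_w w_ge0).

(** Off the kinks the reverse radial Gauss image of eta is the preimage of eta under
tau. The kinks are negligible, and a null modification of a measurable set is
measurable for the completed measure. *)
Lemma dual_curvatureE eta : measurable eta -> dual_curvature q K' eta = nu eta.
Proof.
move=> meta; rewrite /dual_curvature /pushforward_density.
set A := reverse_radial_gauss_image _ _.
have mte : measurable (tau @^-1` eta).
  by rewrite -[X in measurable X]setTI; exact: measurable_normal_direction.
have AN : A `\` N = (tau @^-1` eta `&` sphere) `\` N.
  apply/seteqP; split => v [].
    move=> Av Nv; have v1 : sphere v by case: Av.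
    split=> //; split => //.
    have uniq u (mu : maximizer Omega rho v u) : u = tau v by exact: normal_direction_unique.
    by have := reverse_radial_gauss_imageP Omega_compact Omega0 Omega_sphere Omega_pos
      rho_cont rho_gt0 eta n_gt0 v1 (normal_directionP v) uniq => -[+ _]; apply.
  move=> [ev v1] Nv; split => //.
  have uniq u (mu : maximizer Omega rho v u) : u = tau v by exact: normal_direction_unique.
  by have := reverse_radial_gauss_imageP Omega_compact Omega0 Omega_sphere Omega_pos
    rho_cont rho_gt0 eta n_gt0 v1 (normal_directionP v) uniq => -[_]; apply.
have mN : measurable (N : set lebesgue_rV) by exact: measurable_sub_kinks.
have mtes : measurable (tau @^-1` eta `&` sphere).
  by apply: measurableI => //; exact: measurable_sphere.
have mA : measurable (A : set lebesgue_rV).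
  have -> : A = (A `\` N) `|` (A `&` N).
    apply/seteqP; split => v; last by move=> [[]|[]].
    by have [Nv|Nv] := pselect (N v) => Av; [right|left].
  apply: measurableU; last by apply: measurable_sub_kinks; exact: subIsetr.
  by rewrite AN; exact: measurableD.
have A1 : A `<=` sphere by move=> v [].
have mW : measurable_fun (sphere : set lebesgue_rV) (EFin \o W).
  by apply/measurable_EFinP; exact: measurable_fun_sphere W_cont.
have W0 v : (0 <= (EFin \o W) v)%E by rewrite lee_fin expR_ge0.
have -> : (\int[sigma]_(u in A) (radial K' u `^ q)%:E = \int[sigma]_(u in A) (EFin \o W) u)%E.
  by apply: eq_integral => v /set_mem/A1 v1; rewrite radial_powR.
rewrite (ge0_negligible_integral mN mA) //; last 2 first.
- exact: measurable_funS (@measurable_sphere R n) A1 mW.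
- exact: sphere_measure_kinks.
rewrite AN -(ge0_negligible_integral mN)//; last 2 first.
- exact: measurable_funS (@measurable_sphere R n) (@subIsetr _ _ _) mW.
- exact: sphere_measure_kinks.
rewrite -ge0_integralZl//; last first.
  exact: measurable_funS (@measurable_sphere R n) (@subIsetr _ _ _) mW.
rewrite integral_mkcondr; apply: eq_integral => v _.
rewrite /w !patchE; case: ifPn => // _.
Qed.

Let measurable_EFin_restrict :
  measurable_fun setT ((EFin \o g) \_ Omega : borel_rV R n -> \bar R).
Proof.
have cO : closed Omega by apply: compact_closed => //; exact: norm_hausdorff.
apply/(measurable_restrictT _ _).1; first exact: measurable_closed.
by apply/measurable_EFinP; exact: within_continuous_measurable_rV.
Qed.

Lemma measurable_comp_normal_direction :
  measurable_fun (sphere : set lebesgue_rV) (fun v => g (tau v)).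
Proof.
have mg := measurable_EFin_restrict.
have : measurable_fun setT (((EFin \o g) \_ Omega) \o tau).
  exact: measurableT_comp measurable_normal_direction.
rewrite (_ : _ \o tau = EFin \o (fun v => g (tau v))).
  by move=> /measurable_EFinP; exact: measurable_funTS.
apply/funext => v /=; rewrite patchE mem_set//.
exact: (normal_directionP v).1.
Qed.

Lemma integrable_normal_direction (phi : R -> R) : continuous phi ->
  sigma.-integrable sphere (EFin \o (fun v => g (tau v) * phi (ln (h v)))).
Proof.
move=> /hull_support_continuous_comp cphi.
have [M0 gM0] := compact_bounded_within Omega_compact g_cont.
have [M1 phiM1] := sphere_bounded cphi.
apply: (@bounded_integrable_sphere _ _ n_gt0 _ (M0 * M1)).
  exact: (measurable_funM measurable_comp_normal_direction (measurable_fun_sphere cphi)).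
move=> v v1; rewrite normrM ler_pM//; last exact: phiM1.
by apply: gM0; exact: (normal_directionP v).1.
Qed.

Lemma dual_curvature_integralE :
  dual_curvature_integral q K' Omega g =
  n%:R^-1 * \int[sigma]_(v in sphere) (g (tau v) * expR (- q * ln (h v))).
Proof.
rewrite /dual_curvature_integral (eq_set_function_integral _ _ dual_curvatureE).
have mg := measurable_EFin_restrict.
rewrite integral_mkcond integral_pushforward_density//.
rewrite -RintegralZl; last 2 first.
- exact: measurable_sphere.
- exact: (integrable_normal_direction (@continuous_expRM _ (- q))).
rewrite /Rintegral [in RHS]integral_mkcond; congr fine.
apply: eq_integral => v _; rewrite !patchE /w patchE.
rewrite mem_set; last exact: (normal_directionP v).1.
case: ifPn => _ /=; last by rewrite mule0.
by rewrite -EFinM mulrCA.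
Qed.

End dual_curvature_of_polar.

(** * The variational formulas *)

Lemma is_derive_at0P (R : realType) (f : R -> R) (l : R) :
  is_derive (0 : R) 1 f l <-> (f t - f 0) / t @[t --> 0^'] --> l.
Proof.
have qE : (fun t : R => t^-1 *: ((f \o shift 0) (t *: 1) - f 0)) =
    (fun t => (f t - f 0) / t).
  by apply/funext => t; rewrite /= addr0 /GRing.scale/= mulr1 mulrC.
split=> [[df <-]|ql]; first by rewrite -qE.
by apply: DeriveDef; [apply: cvgP; rewrite qE; exact: ql|rewrite /derive qE; exact/cvg_lim].
Qed.

Lemma derivative_lipschitz_segment (R : realType) (phi phi' : R -> R) (a b : R) :
  (forall x : R, is_derive x 1 phi (phi' x)) -> continuous phi' ->
  exists2 C : R, 0 <= C & forall x y, a <= x <= b -> a <= y <= b ->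
    `|phi x - phi y| <= C * `|x - y|.
Proof.
move=> dphi cphi'.
have cphi : continuous phi.
  by move=> x; apply: differentiable_continuous; apply/derivable1_diffP.
have [M phi'M] := compact_bounded_within (@segment_compact _ a b)
  (continuous_subspaceT cphi').
exists `|M| => //.
have lip x y : x <= y -> a <= x -> y <= b -> `|phi y - phi x| <= `|M| * `|y - x|.
  move=> xy ax yb.
  have [|z zxy ->] := MVT_segment xy (fun z _ => dphi z).
    exact: continuous_subspaceT.
  rewrite normrM ler_wpM2r// (le_trans _ (ler_norm M))// phi'M//=.
  move: zxy; rewrite !in_itv/= => /andP[xz zy].
  by rewrite (le_trans ax)// (le_trans zy).
move=> x y /andP[ax xb] /andP[ay yb].
have [xy|yx] := leP x y; last by apply: lip => //; exact: ltW.
by rewrite distrC (distrC x); exact: lip.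
Qed.

Lemma ln_normalized_dual_volume0 (R : realType) n (K : set 'rV[R]_n) I :
  \int[sphere_measure (n:=n)]_(u in sphere) ln (radial K u) = I ->
  ln (normalized_dual_volume 0 K) = (n%:R * unit_ball_volume R n)^-1 * I.
Proof. by move=> <-; rewrite /normalized_dual_volume eqxx expRK. Qed.

Lemma ln_normalized_dual_volume (R : realType) n (K : set 'rV[R]_n) q I : q != 0 ->
  \int[sphere_measure (n:=n)]_(u in sphere) (radial K u `^ q) = I ->
  ln (normalized_dual_volume q K) = q^-1 * ln ((n%:R * unit_ball_volume R n)^-1 * I).
Proof. by move=> q0 <-; rewrite /normalized_dual_volume (negbTE q0) ln_powR. Qed.

Section variation.
Context (R : realType) (n : nat).
Variables (Omega : set 'rV[R]_n) (rho : R -> 'rV[R]_n -> R) (g : 'rV[R]_n -> R).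
Hypothesis n_gt0 : (0 < n)%N.
Hypothesis Omega_compact : compact Omega.
Hypothesis Omega0 : Omega !=set0.
Hypothesis Omega_sphere : Omega `<=` sphere.
Hypothesis Omega_pos : forall x : 'rV[R]_n, x != 0 -> exists2 u, Omega u & 0 < dot u x.
Hypothesis g_cont : {within Omega, continuous g}.
Hypothesis rho_near : \forall t \near (0 : R),
  {within Omega, continuous (rho t)} /\ forall u, Omega u -> 0 < rho t u.
Hypothesis rho_log : forall e : R, 0 < e -> \forall t \near (0 : R),
  forall u, Omega u -> `|ln (rho t u) - ln (rho 0 u) - t * g u| <= e * `|t|.

Local Notation sigma := (@sphere_measure R n).
Local Notation h t v := (hull_support Omega (rho t) v).
Local Notation tau := (normal_direction Omega (rho 0)).
Local Notation K' t := (polar (hull_of Omega (rho t))).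

Let rho0_cont : {within Omega, continuous (rho 0)}.
Proof. by have [] := nbhs_singleton rho_near. Qed.

Let rho0_gt0 u : Omega u -> 0 < rho 0 u.
Proof. by have [_] := nbhs_singleton rho_near; exact. Qed.

(** The common core of the formulas: phi r = exp (- q r) gives the dual volumes and
phi r = - r the logarithmic one. As ln h_0 is bounded on the sphere, phi is
Lipschitz on the range of all ln h_t with t small, which gives the dominating
constant. *)
Lemma derivative_integral_ln_hull_support (phi phi' : R -> R) :
  (forall x : R, is_derive x 1 phi (phi' x)) -> continuous phi' ->
  (\int[sigma]_(v in sphere) phi (ln (h t v)) -
   \int[sigma]_(v in sphere) phi (ln (h 0 v))) / t @[t --> 0^'] -->
  \int[sigma]_(v in sphere) (g (tau v) * phi' (ln (h 0 v))).
Proof.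
move=> dphi cphi'.
have cphi : continuous phi.
  by move=> x; apply: differentiable_continuous; apply/derivable1_diffP.
have [M hM] := ln_hull_support_lipschitz Omega_compact Omega0 g_cont rho_near rho_log.
have hM' : \forall t \near (0 : R), forall v, sphere v ->
    `|ln (h t v) - ln (h 0 v)| <= `|M| * `|t|.
  apply: filterS hM => t ht v v1.
  have [u Ou uv] := Omega_pos (sphere_neq0 v1).
  by rewrite (le_trans (ht v u Ou uv))// ler_wpM2r// ler_norm.
have [B hB] : exists B : R, forall v, sphere v -> `|ln (h 0 v)| <= B.
  apply: sphere_bounded.
  by apply: (hull_support_continuous_comp Omega_compact Omega0 Omega_pos
    rho0_cont rho0_gt0 (phi := id)) => x; exact: cvg_id.
have [C C0 lipC] := derivative_lipschitz_segment (- (B + 1)) (B + 1) dphi cphi'.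
have near_small : \forall t \near (0 : R), `|t| <= (`|M| + 1)^-1.
  by apply: (@nbhs0_le _ R^o); rewrite invr_gt0 ltr_wpDl.
apply: (derivative_under_Rintegral (M := C * `|M|)).
- exact: measurable_sphere.
- exact: sphere_measure_lty.
- apply: filterS rho_near => t [ct gt].
  apply: continuous_integrable_sphere => //.
  exact: hull_support_continuous_comp.
- near=> t => v v1.
  have ht : `|ln (h t v) - ln (h 0 v)| <= `|M| * `|t| by move: v v1; near: t.
  have small : `|M| * `|t| <= 1.
    have tM : `|t| <= (`|M| + 1)^-1 by near: t.
    rewrite (@le_trans _ _ (`|M| * (`|M| + 1)^-1)) ?ler_wpM2l//.
    by rewrite ler_pdivrMr ?ltr_wpDl// mul1r lerDl.
  have := hB v v1; rewrite ler_norml => /andP[B1 B2].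
  have := le_trans ht small; rewrite ler_norml => /andP[t1 t2].
  rewrite (le_trans (lipC _ _ _ _))//; last by rewrite -mulrA ler_wpM2l.
    by apply/andP; split; lra.
  by apply/andP; split; lra.
- exists (kinks Omega (rho 0)); split.
  + exact: (measurable_sub_kinks Omega_compact Omega0 rho0_cont (@subset_refl _ _)).
  + exact: sphere_measure_kinks.
  move=> v /= /not_implyP[v1]; apply: contra_notP => Nv.
  have [u Ou uv] := Omega_pos (sphere_neq0 v1).
  have mt := normal_directionP Omega_compact Omega0 rho0_cont v.
  have tv : 0 < dot (tau v) v.
    have := hull_support_pos Omega_compact Omega0 Omega_pos rho0_cont rho0_gt0 (sphere_neq0 v1).
    rewrite (maximizerE Omega_compact rho0_cont Omega0 mt).
    by rewrite pmulr_rgt0//; apply: rho0_gt0; exact: mt.1.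
  have uniq w : maximizer Omega (rho 0) v w -> w = tau v.
    exact: normal_direction_unique.
  have cl := cvg_ln_hull_support Omega_compact Omega0 g_cont rho_near rho_log mt.1 tv mt uniq.
  apply/is_derive_at0P; rewrite mulrC.
  apply: (is_derive1_comp (f := phi) (g := fun t => ln (h t v))).
  exact/is_derive_at0P.
- exact/measurable_EFinP/(measurable_int sigma)/integrable_normal_direction.
Unshelve. all: by end_near. Qed.

Local Notation omega := (unit_ball_volume R n).
Local Notation D q := (dual_curvature_integral q (K' 0) Omega g).

Let Phi q t := \int[sigma]_(v in sphere) expR (- q * ln (h t v)).

Let powR_integrandE q : \forall t \near (0 : R),
  \int[sigma]_(v in sphere) (radial (K' t) v `^ q) = Phi q t.
Proof.
apply: filterS rho_near => t [ct gt].
by apply: eq_Rintegral => v /set_mem v1; exact: radial_powR.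
Qed.

Let ln_integrandE : \forall t \near (0 : R),
  \int[sigma]_(v in sphere) ln (radial (K' t) v) =
  \int[sigma]_(v in sphere) - ln (h t v).
Proof.
apply: filterS rho_near => t [ct gt].
apply: eq_Rintegral => v /set_mem v1; have v0 := sphere_neq0 v1.
by rewrite radial_polar_hull// lnV// posrE; exact: hull_support_pos.
Qed.

Let is_derive_Phi q : is_derive (0 : R) 1 (Phi q) (- q * (n%:R * D q)).
Proof.
have n0 : n%:R != 0 :> R by rewrite pnatr_eq0 -lt0n.
have dphi (x : R) :
    is_derive (x : R) 1 (fun r : R => expR (- q * r)) (- q * expR (- q * x)).
  have dm : is_derive (x : R) 1 (fun r : R => - q * r) (- q).
    have := is_deriveZ (- q) (is_derive_id x (1 : R)).
    by rewrite /GRing.scale/= mulr1.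
  by rewrite mulrC; exact: (is_derive1_comp (is_derive_expR _) dm).
have cphi := @continuous_expRM R (- q).
have cphi' : continuous (fun x : R => - q * expR (- q * x)).
  by move=> x; apply: cvgM; [exact: cvg_cst|exact: cphi].
apply/is_derive_at0P.
have := derivative_integral_ln_hull_support dphi cphi'.
rewrite dual_curvature_integralE// mulVKf//.
rewrite -RintegralZl; last 2 first.
- exact: measurable_sphere.
- exact: (integrable_normal_direction n_gt0 Omega_compact Omega0 Omega_sphere
    Omega_pos rho0_cont rho0_gt0 g_cont cphi).
have -> : \int[sigma]_(v in sphere) (- q * (g (tau v) * expR (- q * ln (h 0 v)))) =
    \int[sigma]_(v in sphere) (g (tau v) * (- q * expR (- q * ln (h 0 v)))).
  by apply: eq_Rintegral => v _; rewrite mulrCA.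
exact.
Qed.

Let sphere_measure_pos : 0 < n%:R * omega.
Proof. by rewrite mulr_gt0 ?ltr0n// unit_ball_volume_gt0. Qed.

Let Phi_gt0 q : 0 < Phi q 0.
Proof.
have [B hB] : exists B : R, forall v, sphere v -> `|ln (h 0 v)| <= B.
  apply: sphere_bounded.
  by apply: (hull_support_continuous_comp Omega_compact Omega0 Omega_pos
    rho0_cont rho0_gt0 (phi := id)) => x; exact: cvg_id.
apply: (@lt_le_trans _ _ (\int[sigma]_(v in sphere) expR (- (`|q| * B)))).
  rewrite Rintegral_cst; last exact: measurable_sphere.
  rewrite mulr_gt0 ?expR_gt0// [X in fine X](sphere_measure_sphere R n_gt0).
  exact: sphere_measure_pos.
apply: le_Rintegral.
- exact: measurable_sphere.
- apply: measurable_bounded_integrable => //.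
  + exact: measurable_sphere.
  + exact: sphere_measure_lty.
  + exact: bounded_cst.
- apply: continuous_integrable_sphere => //.
  exact: (hull_support_continuous_comp Omega_compact Omega0 Omega_pos
    rho0_cont rho0_gt0 (@continuous_expRM _ (- q))).
- move=> v v1; rewrite ler_expR mulNr lerN2 (le_trans (ler_norm _))// normrM.
  by rewrite ler_wpM2l// hB.
Qed.

Lemma derivative_dual_volume q :
  (dual_volume q (K' t) - dual_volume q (K' 0)) / t @[t --> 0^'] --> - q * D q.
Proof.
have n0 : n%:R != 0 :> R by rewrite pnatr_eq0 -lt0n.
have : is_derive (0 : R) 1 (fun t => n%:R^-1 * Phi q t) (- q * D q).
  have := is_deriveZ n%:R^-1 (is_derive_Phi q).
  by rewrite /GRing.scale/= mulrCA mulKf.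
move/is_derive_at0P; apply: cvg_trans; apply: near_eq_cvg.
have E := powR_integrandE q; have E0 := nbhs_singleton E.
apply: nbhs_dnbhs; apply: filterS E => t Et.
exact: (congr2 (fun a b => (n%:R^-1 * a - n%:R^-1 * b) / t) (esym Et) (esym E0)).
Qed.

Lemma derivative_ln_normalized_dual_volume0 :
  (ln (normalized_dual_volume 0 (K' t)) - ln (normalized_dual_volume 0 (K' 0))) / t
    @[t --> 0^'] --> - omega^-1 * D 0.
Proof.
have n0 : n%:R != 0 :> R by rewrite pnatr_eq0 -lt0n.
have dN (x : R) : is_derive (x : R) 1 (fun r : R => - r) (- 1).
  exact: is_deriveN (is_derive_id x (1 : R)).
have cN : continuous (fun _ : R => - 1 : R) by exact: cst_continuous.
have := derivative_integral_ln_hull_support dN cN.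
move/is_derive_at0P => dI.
have vE : (n%:R * omega)^-1 * (\int[sigma]_(v in sphere) (g (tau v) * -1)) =
    - omega^-1 * D 0.
  have -> : \int[sigma]_(v in sphere) (g (tau v) * -1) =
      - \int[sigma]_(v in sphere) (g (tau v) * expR (- 0 * ln (h 0 v))).
    rewrite -[RHS]mulN1r -RintegralZl; last 2 first.
    - exact: measurable_sphere.
    - exact: (integrable_normal_direction n_gt0 Omega_compact Omega0 Omega_sphere
        Omega_pos rho0_cont rho0_gt0 g_cont (@continuous_expRM _ (- 0))).
    by apply: eq_Rintegral => v _; rewrite oppr0 mul0r expR0 mulr1 mulrC.
  rewrite dual_curvature_integralE// invfM mulrN mulNr; congr (- _).
  by rewrite mulrA (mulrC n%:R^-1).
have : is_derive (0 : R) 1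
    (fun t => (n%:R * omega)^-1 * \int[sigma]_(v in sphere) - ln (h t v))
    (- omega^-1 * D 0).
  by rewrite -vE; exact: (is_deriveZ (n%:R * omega)^-1 dI).
move/is_derive_at0P; apply: cvg_trans; apply: near_eq_cvg.
have E := ln_integrandE; have E0 := nbhs_singleton E.
apply: nbhs_dnbhs; apply: filterS E => t Et.
exact: (congr2 (fun a b => (a - b) / t) (esym (ln_normalized_dual_volume0 Et))
  (esym (ln_normalized_dual_volume0 E0))).
Qed.

Lemma derivative_ln_normalized_dual_volume (q : R) : q != 0 ->
  (ln (normalized_dual_volume q (K' t)) - ln (normalized_dual_volume q (K' 0))) / t
    @[t --> 0^'] --> - (dual_volume q (K' 0))^-1 * D q.
Proof.
move=> q0; have n0 : n%:R != 0 :> R by rewrite pnatr_eq0 -lt0n.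
have E := powR_integrandE q; have E0 := nbhs_singleton E.
have Phi0 := Phi_gt0 q.
have c0 : 0 < (n%:R * omega)^-1 by rewrite invr_gt0 sphere_measure_pos.
have : is_derive (0 : R) 1 (fun t => q^-1 * ln ((n%:R * omega)^-1 * Phi q t))
    (- (dual_volume q (K' 0))^-1 * D q).
  have dc := is_deriveZ (n%:R * omega)^-1 (is_derive_Phi q).
  have dl := is_derive1_comp (g := (n%:R * omega)^-1 \*: Phi q)
    (is_derive1_ln (mulr_gt0 c0 Phi0)) dc.
  suff <- : q^-1 * (((n%:R * omega)^-1 * Phi q 0)^-1 *
      ((n%:R * omega)^-1 * (- q * (n%:R * D q)))) =
      - (dual_volume q (K' 0))^-1 * D q by exact: (is_deriveZ q^-1 dl).
  rewrite /dual_volume E0; move: (D q) => d.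
  have o0 : omega != 0 by rewrite gt_eqF// unit_ball_volume_gt0.
  have P0 : Phi q 0 != 0 by rewrite gt_eqF.
  by field; rewrite q0 n0 o0 P0.
move/is_derive_at0P; apply: cvg_trans; apply: near_eq_cvg.
apply: nbhs_dnbhs; apply: filterS E => t Et.
exact: (congr2 (fun a b => (a - b) / t) (esym (ln_normalized_dual_volume q0 Et))
  (esym (ln_normalized_dual_volume q0 E0))).
Qed.

Lemma dual_volume0 : dual_volume 0 (K' 0) = omega.
Proof.
have n0 : n%:R != 0 :> R by rewrite pnatr_eq0 -lt0n.
rewrite /dual_volume; under eq_Rintegral do rewrite powRr0.
rewrite Rintegral_cst; last exact: measurable_sphere.
by rewrite [X in fine X](sphere_measure_sphere R n_gt0) mul1r /= mulKf.
Qed.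

End variation.

(** The three features of a logarithmic family used in the proof. The last one also
holds at t = 0, where the remainder vanishes; this avoids punctured
neighbourhoods. *)
Lemma log_family_uniform (R : realType) (n : nat) (Omega : set 'rV[R]_n)
    (rho0 g : 'rV[R]_n -> R) (rho : R -> 'rV[R]_n -> R) :
  log_family Omega rho0 g rho ->
  [/\ forall u, Omega u -> rho 0 u = rho0 u,
    \forall t \near (0 : R), {within Omega, continuous (rho t)} /\
      forall u, Omega u -> 0 < rho t u &
    forall e : R, 0 < e -> \forall t \near (0 : R), forall u, Omega u ->
      `|ln (rho t u) - ln (rho 0 u) - t * g u| <= e * `|t|].
Proof.
move=> [rho_0 [delta d0 [rem [cont_pos _ lnE o_small]]]].
have near_delta : \forall t \near (0 : R), `|t| < delta by exact: (@nbhs0_lt _ R^o).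
split=> //; first by apply: filterS near_delta => t /cont_pos.
move=> e e0; have := o_small e e0; rewrite /dnbhs /within /= => near_o.
near=> t => u Ou.
have td : `|t| < delta by near: t.
rewrite lnE// (rho_0 u Ou).
have [->|t0] := eqVneq t 0.
  have := lnE 0; rewrite normr0 => /(_ d0 u Ou) <-.
  by rewrite rho_0// subrr mul0r subr0 !normr0 mulr0.
have : `|rem t u / t| < e.
  by move: u Ou; move: t0; near: t.
rewrite normrM normfV ltr_pdivrMr ?normr_gt0// => /ltW.
by congr (`|_| <= _); ring.
Unshelve. all: by end_near. Qed.

Theorem theorem4p4 (R : realType) (n : nat) (n_gt0 : (0 < n)%N)
  (Omega : set 'rV[R]_n)
  (Omega_sphere : Omega `<=` sphere)
  (Omega_closed : closed Omega)
  (Omega_hemi : forall v, sphere v -> ~ (Omega `<=` closed_hemisphere v))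
  (rho0 g : 'rV[R]_n -> R)
  (rho0_cont : {within Omega, continuous rho0})
  (rho0_gt0 : forall u, Omega u -> 0 < rho0 u)
  (g_cont : {within Omega, continuous g})
  (rho : R -> 'rV[R]_n -> R)
  (rho_log : log_family Omega rho0 g rho) :
  [/\ forall q : R, q != 0 ->
        (dual_volume q (polar (hull_of Omega (rho t))) -
         dual_volume q (polar (hull_of Omega rho0))) / t @[t --> 0^'] -->
        - q * dual_curvature_integral q (polar (hull_of Omega rho0)) Omega g,
      (ln (normalized_dual_volume 0 (polar (hull_of Omega (rho t)))) -
       ln (normalized_dual_volume 0 (polar (hull_of Omega rho0)))) / t
        @[t --> 0^'] -->
      - (unit_ball_volume R n)^-1 *
        dual_curvature_integral 0 (polar (hull_of Omega rho0)) Omega g &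
      forall q : R,
        is_derive (0 : R) 1
          (fun t : R =>
             ln (normalized_dual_volume q (polar (hull_of Omega (rho t)))))
          (- (dual_volume q (polar (hull_of Omega rho0)))^-1 *
           dual_curvature_integral q (polar (hull_of Omega rho0)) Omega g)].
Proof.
have [rho_0 rho_near rho_ln] := log_family_uniform rho_log.
have -> : hull_of Omega rho0 = hull_of Omega (rho 0).
  by rewrite /hull_of; congr convex_hull; apply: eq_imagel => u Ou; rewrite rho_0.
have Omega_compact : compact Omega.
  by apply: subclosed_compact Omega_closed (@compact_sphere R n) Omega_sphere.
have Omega_neg v : sphere v -> exists2 u, Omega u & dot u v < 0.
  move=> v1; apply: contrapT => nu; apply: (Omega_hemi v v1) => u Ou.
  split; first exact: Omega_sphere.
  by rewrite leNgt; apply/negP => uv; apply: nu; exists u.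
have Omega_pos (x : 'rV[R]_n) : x != 0 -> exists2 u, Omega u & 0 < dot u x.
  move=> x0; have nx : 0 < enorm x by rewrite enorm_gt0.
  have [|u Ou ux] := Omega_neg (- (enorm x)^-1 *: x).
    by rewrite /sphere/= enormZ normrN gtr0_norm ?invr_gt0// mulVf// gt_eqF.
  exists u => //; move: ux; rewrite dotZr mulNr oppr_lt0 pmulr_rgt0//.
  by rewrite invr_gt0.
have Omega0 : Omega !=set0.
  have [|u Ou _] := Omega_pos (delta_mx 0 (Ordinal n_gt0)); last by exists u.
  apply/eqP => /rowP/(_ (Ordinal n_gt0)); rewrite !mxE !eqxx => /eqP.
  by rewrite oner_eq0.
split.
- move=> q _; exact: derivative_dual_volume.
- exact: derivative_ln_normalized_dual_volume0.
- move=> q; apply/is_derive_at0P.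
  have [->|q0] := eqVneq q 0; last exact: derivative_ln_normalized_dual_volume.
  by rewrite dual_volume0//; exact: derivative_ln_normalized_dual_volume0.
Qed.
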